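(* Let $$p(x,y)=x^{6}y^{5}-5x^{5}y^{4}+10x^{4}y^{3}-2x^{3}y^{3}-10x^{3}y^{2}+5x^{2}y^{2}+5x^{2}y-\tfrac{15}{4}xy-x+y\in\mathbb{C}[x,y].$$ Then $p$ has two non-zero critical values at infinity, and the curve $p(x,y)=0$ has two branches at infinity.
   Context: For $f\in\mathbb{C}[x,y]$ of degree $D$, consider the rational extension $\tilde f:\mathbb{P}^2\dashrightarrow\mathbb{P}^1$, $[X:Y:Z]\mapsto Z^Df(X/Z,Y/Z)/Z^D$. Its base points are the points of the line at infinity $Z=0$ where the top degree form $f_D$ vanishes; at each base point $P_0$ the germ of $\tilde f$ is a special pencil $r=g/z^D$, where $z=0$ is a local equation of the line at infinity and $g$ is the local equation of the closure of $f=0$, and the fibres are $C_t=\{g-tz^D=0\}$. The branches at infinity of the curve $f=0$ are the branches of its projective closure at the points of the line at infinity. Let $\pi:S\to(\mathbb{P}^2,P_0)$ be the minimal composition of point blow-ups such that $\pi^*(r)$ is a morphism to $\mathbb{P}^1$. A component $E$ of $\pi^{-1}(P_0)$ is dicritical if $\pi^*(r)|_E$ is non-constant; then $\pi^*(r)|_E$ is a polynomial map of some degree $d_E$. A value $t\in\mathbb{C}$ is typical at $E$ if the branches of the strict transform of $C_t$ meeting $E$ are exactly $d_E$ non-singular branches transversal to $E$, at $d_E$ distinct points of $E$; otherwise it is atypical at $E$. The critical (atypical) values at infinity of $f$ are the $t\in\mathbb{C}$ that are atypical at some dicritical over some base point at infinity. *)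

(* Defs.v *)
From mathcomp Require Import all_boot all_order all_algebra.
From mathcomp Require Import reals.
From mathcomp Require Export complex.

Set Implicit Arguments.
Unset Strict Implicit.
Unset Printing Implicit Defensive.

Import GRing.Theory.
Local Open Scope ring_scope.

(* A polynomial in two variables is an element G of {poly {poly F}}: the inner *)
(* variable 'X%:P is the first coordinate (x, or u) and the outer variable 'X  *)
(* is the second one (y, or v); the coefficient of u^i v^j is G`_j`_i.         *)

Section Polynomials.

Variable F : fieldType.
Implicit Types (f G H : {poly {poly F}}).

Definition tdeg f : nat :=
  (\max_(j < size f | (f`_j != 0)%R) (j + (size (f`_j)%R).-1))%N.

Definition top_form f (a b : F) : F :=
  \sum_(j < size f) \sum_(i < size f`_j | (i + j == tdeg f)%N)
    f`_j`_i * a ^+ i * b ^+ j.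

(* G(A, B) *)
Definition psubst G (A B : {poly {poly F}}) : {poly {poly F}} :=
  \sum_(j < size G) \sum_(i < size G`_j) (G`_j`_i)%:P%:P * A ^+ i * B ^+ j.

(* X^i Y^j Z^(D - i - j), summed: Z^D f(X/Z, Y/Z) with D = tdeg f *)
Definition homogenize f (X Y Z : {poly {poly F}}) : {poly {poly F}} :=
  \sum_(j < size f) \sum_(i < size f`_j)
    (f`_j`_i)%:P%:P * X ^+ i * Y ^+ j * Z ^+ (tdeg f - i - j).

Definition at_origin G : F := G`_0`_0.

End Polynomials.

(* Formal power series in two variables: A i j is the coefficient of u^i v^j. *)
Section Series.

Variable F : fieldType.

Definition series := nat -> nat -> F.

Implicit Types (A B U Q : series).

Definition smul A B : series := fun i j =>
  \sum_(k < i.+1) \sum_(l < j.+1) A k l * B (i - k)%N (j - l)%N.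

Definition sone : series := fun i j => ((i == 0%N) && (j == 0%N))%:R.

Definition sunit A : Prop := exists B, smul A B =2 sone.

Definition sirreducible A : Prop :=
  ~ sunit A /\ forall B Q, A =2 smul B Q -> sunit B \/ sunit Q.

Definition sassoc A B : Prop := exists2 U, sunit U & A =2 smul U B.

Definition series_of_poly (G : {poly {poly F}}) : series := fun i j => G`_j`_i.

(* The branches at the origin of the curve G = 0 are the irreducible factors  *)
(* of G in F[[u, v]]; associated factors define the same branch.              *)
Definition branch (G : {poly {poly F}}) B : Prop :=
  sirreducible B /\ exists Q, series_of_poly G =2 smul B Q.

Definition nonsingular B : Prop := B 1%N 0%N != 0 \/ B 0%N 1%N != 0.

(* for nonsingular germs B = 0 and L = 0: distinct tangent lines *)
Definition transversal B (L : {poly {poly F}}) : Prop :=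
  B 1%N 0%N * L`_1`_0 - B 0%N 1%N * L`_0`_1 != 0.

End Series.

Section BlowUps.

Variable F : fieldType.

(* The projective line: Some c is [1 : c], None is [0 : 1].                   *)
Definition P1 : Type := option F.

(* The points of the exceptional curve of the blow-up of the origin are the   *)
(* directions d : P1, with local coordinates (u', v') centred at d given by   *)
(*   (u, v) = (u', u' (v' + c)) if d = Some c,  (u, v) = (u' v', v') if None. *)
Definition pull (d : P1) (G : {poly {poly F}}) : {poly {poly F}} :=
  match d with
  | Some c => psubst G 'X%:P ('X%:P * ('X + c%:P%:P))
  | None => psubst G ('X%:P * 'X) 'X
  end.

(* local equation at d of the exceptional curve *)
Definition exc (d : P1) : {poly {poly F}} :=
  match d with Some _ => 'X%:P | None => 'X end.

(* A point infinitely near to P0: [::] is P0 itself, and rcons q d is the     *)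
(* point d of the exceptional curve of the blow-up of q.                      *)
Definition ipoint : Type := seq P1.

Definition total (q : ipoint) (G : {poly {poly F}}) : {poly {poly F}} :=
  foldl (fun G' d => pull d G') G q.

Definition strict1 (d : P1) (G G' : {poly {poly F}}) : Prop :=
  (exists m : nat, pull d G = exc d ^+ m * G') /\
  ~ (exists Q, G' = exc d * Q).

Fixpoint strict (q : ipoint) (G G' : {poly {poly F}}) : Prop :=
  match q with
  | [::] => G' = G
  | d :: q' => exists2 G1, strict1 d G G1 & strict q' G1 G'
  end.

(* A composition of point blow-ups over P0 is given by the finite set K of    *)
(* the points that are blown up.                                              *)
Definition blowups (K : seq ipoint) : Prop :=
  forall q d, rcons q d \in K -> q \in K.

(* q is a point, lying over P0, of the surface obtained by blowing up K *)
Definition on_surface (K : seq ipoint) (q : ipoint) : Prop :=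
  q \notin K /\ forall q' d, q = rcons q' d -> q' \in K.

Section Pencil.

Variables G H : {poly {poly F}}.

(* The pull-back of r = G/H defines a map to the projective line near q. *)
Definition defined_at (q : ipoint) : Prop :=
  exists A B : {poly {poly F}},
    A * total q H = B * total q G /\ (at_origin A != 0 \/ at_origin B != 0).

Definition resolution (K : seq ipoint) : Prop :=
  blowups K /\ forall q, on_surface K q -> defined_at q.

Definition minimal_resolution (K : seq ipoint) : Prop :=
  resolution K /\ forall K', resolution K' -> {subset K <= K'}.

(* E_s is the exceptional curve of the blow-up of s, as well as its strict    *)
(* transforms. In the chart rcons s (Some 0) its affine part is u = 0, with   *)
(* coordinate v; there the pull-back of r = G/H is A/B, and a/b is the        *)
(* restriction of A/B to u = 0 written in lowest terms. The degree of a/b as  *)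
(* a map from the projective line to itself is max (deg a, deg b).            *)
Definition restriction (s : ipoint) (a b : {poly F}) : Prop :=
  coprimep a b /\
  exists (A B : {poly {poly F}}) (k : {poly F}),
    [/\ A * total (rcons s (Some 0)) H = B * total (rcons s (Some 0)) G,
        k != 0,
        map_poly (horner_eval 0) A = k * a
      & map_poly (horner_eval 0) B = k * b].

Definition restriction_degree (s : ipoint) (n : nat) : Prop :=
  exists2 ab, restriction s ab.1 ab.2 & n = (maxn (size ab.1) (size ab.2)).-1.

(* E_s is dicritical (the restriction is non-constant), and d_E = n *)
Definition dicritical (K : seq ipoint) (s : ipoint) (n : nat) : Prop :=
  [/\ s \in K, restriction_degree s n & (0 < n)%N].

(* q is a point of E_s on the surface of K, and L is an equation of E_s at q *)
Definition point_of_component (K : seq ipoint) (s q : ipoint)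
    (L : {poly {poly F}}) : Prop :=
  on_surface K q /\
  exists d w, [/\ q = s ++ d :: w, strict w (exc d) L & at_origin L = 0].

(* B is a branch at q, a point of E_s, of the strict transform of C_t *)
Definition branch_on (K : seq ipoint) (s : ipoint) (t : F) (q : ipoint)
    (L : {poly {poly F}}) (B : series F) : Prop :=
  point_of_component K s q L /\
  exists2 Ct, strict q (G - t%:P%:P * H) Ct & branch Ct B.

Definition typical (K : seq ipoint) (s : ipoint) (n : nat) (t : F) : Prop :=
  exists (q : 'I_n -> ipoint) (B : 'I_n -> series F),
    [/\ injective q,
        forall i, exists L, [/\ branch_on K s t (q i) L (B i),
                                nonsingular (B i) & transversal (B i) L]
      & forall q' L' B', branch_on K s t q' L' B' ->
          exists2 i, q' = q i & sassoc B' (B i)].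

Definition atypical_at_dicritical (t : F) : Prop :=
  exists K, minimal_resolution K /\
  exists s n, dicritical K s n /\ ~ typical K s n t.

End Pencil.

End BlowUps.

Section Infinity.

Variable F : fieldType.
Variable f : {poly {poly F}}.

(* The point of the line at infinity with P = Some b is [1 : b : 0], with     *)
(* local coordinates (z, v) <-> [1 : b + v : z]; None is [0 : 1 : 0], with    *)
(* local coordinates (z, v) <-> [v : 1 : z]. In both cases z is 'X%:P.        *)
Definition base_point (P : P1 F) : Prop :=
  match P with
  | Some b => top_form f 1 b = 0
  | None => top_form f 0 1 = 0
  end.

Definition germ_at_infinity (P : P1 F) : {poly {poly F}} :=
  match P with
  | Some b => homogenize f 1 ('X + b%:P%:P) 'X%:P
  | None => homogenize f 'X 1 'X%:P
  end.

Definition critical_value_at_infinity (t : F) : Prop :=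
  exists2 P, base_point P &
    atypical_at_dicritical (germ_at_infinity P) ('X%:P ^+ tdeg f) t.

Definition branch_at_infinity (P : P1 F) (B : series F) : Prop :=
  branch (germ_at_infinity P) B.

Definition number_of_branches_at_infinity (n : nat) : Prop :=
  exists (P : 'I_n -> P1 F) (B : 'I_n -> series F),
    [/\ forall i, branch_at_infinity (P i) (B i),
        forall i j, P i = P j -> sassoc (B i) (B j) -> i = j
      & forall P' B', branch_at_infinity P' B' ->
          exists2 i, P' = P i & sassoc B' (B i)].

End Infinity.

(* Main.v *)
From HB Require Import structures.
Require Import Defs.
From mathcomp Require Import all_boot all_order all_algebra.
From mathcomp Require Import reals complex.
From mathcomp Require Import ring zify.

(** The points at infinity of [p] are [1 : 0 : 0] and [0 : 1 : 0]. Over each of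
    them the base point of the pencil [g / z^11] stays in a single direction
    through six blow-ups: whenever [G] has multiplicity [m], its tangent cone is
    the [m]-th power of one linear form, and [H] vanishes to order at least [m].
    So the minimal resolution blows up a chain of seven points, the fibration is
    constant on the first six exceptional curves, and on the last one, where the
    pencil reads [(v + u R) / (u W)], it has degree 1. The strict transform of
    a fibre crosses that curve transversally once, unless its value is the one
    taken at the intersection with the other components, in which case it does
    not meet the curve. The two exceptional values are [3 - 15/4 = -3/4] and
    [-5/8].

    The same chains give the branches of [p = 0]: since every tangent cone is a
    power of a linear form, a factorization of the germ in [F[[u, v]]] would
    descend to its last strict transform, which is smooth. *)

Set Implicit Arguments.
Unset Strict Implicit.
Unset Printing Implicit Defensive.

Import GRing.Theory Num.Theory.
Local Open Scope ring_scope.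
Local Open Scope complex_scope.

(** * Blow-up charts *)

Section Pull.

Variable F : fieldType.
Implicit Types (A B G H M : {poly {poly F}}) (d : P1 F).

Lemma comm_constant A : commr_rmorph (polyC \o polyC : F -> {poly {poly F}}) A.
Proof. by move=> c; apply: mulrC. Qed.

Lemma comm_inner A B : commr_rmorph (horner_morph (comm_constant A)) B.
Proof. by move=> c; apply: mulrC. Qed.

(** The double sum is the evaluation morphism sending the two variables to [A] and [B]; every chart
    map inherits its ring-morphism structure from here. *)
Lemma psubstE A B G : psubst G A B = horner_morph (comm_inner A B) G.
Proof.
rewrite /psubst -[in RHS](coefK G) poly_def rmorph_sum; apply: eq_bigr => j _ /=.
rewrite -mul_polyC rmorphM rmorphXn /= horner_morphC horner_morphX.
rewrite -[in RHS](coefK G`_j) poly_def rmorph_sum mulr_suml.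
apply: eq_bigr => i _ /=.
by rewrite -mul_polyC rmorphM rmorphXn /= horner_morphC horner_morphX.
Qed.

Lemma psubst_is_zmod_morphism A B : zmod_morphism (fun G => psubst G A B).
Proof. by move=> G H; rewrite !psubstE rmorphB. Qed.

Lemma psubst_is_monoid_morphism A B : monoid_morphism (fun G => psubst G A B).
Proof.
by split=> [|G H]; rewrite !psubstE ?rmorph1 // rmorphM.
Qed.

Lemma psubst_const A B c : psubst c%:P%:P A B = c%:P%:P.
Proof. by rewrite psubstE horner_morphC /= horner_morphC. Qed.

Lemma psubst_inner A B : psubst 'X%:P A B = A.
Proof. by rewrite psubstE horner_morphC /= horner_morphX. Qed.

Lemma psubst_outer A B : psubst 'X A B = B.
Proof. by rewrite psubstE horner_morphX. Qed.

Lemma pull_is_zmod_morphism d : zmod_morphism (pull d).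
Proof. by case: d => [c|] G H /=; apply: psubst_is_zmod_morphism. Qed.

Lemma pull_is_monoid_morphism d : monoid_morphism (pull d).
Proof. by case: d => [c|] /=; apply: psubst_is_monoid_morphism. Qed.

HB.instance Definition _ d := GRing.isZmodMorphism.Build
  {poly {poly F}} {poly {poly F}} (pull d) (pull_is_zmod_morphism d).
HB.instance Definition _ d := GRing.isMonoidMorphism.Build
  {poly {poly F}} {poly {poly F}} (pull d) (pull_is_monoid_morphism d).

Lemma pullB d G H : pull d (G - H) = pull d G - pull d H.
Proof. exact: pull_is_zmod_morphism. Qed.

Lemma pullD d G H : pull d (G + H) = pull d G + pull d H.
Proof. exact: raddfD. Qed.

Lemma pullM d G H : pull d (G * H) = pull d G * pull d H.
Proof. by case: (pull_is_monoid_morphism d). Qed.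

Lemma pullX d G n : pull d (G ^+ n) = pull d G ^+ n.
Proof. exact: rmorphXn. Qed.

Lemma pull_nat d n : pull d n%:R = n%:R.
Proof. exact: rmorph_nat. Qed.

Lemma pull1 d : pull d 1 = 1.
Proof. exact: rmorph1. Qed.

Lemma pull_const d c : pull d c%:P%:P = c%:P%:P.
Proof. by case: d => [b|] /=; rewrite psubst_const. Qed.

Lemma pull_inner d :
  pull d 'X%:P = if d is Some _ then 'X%:P else 'X%:P * 'X.
Proof. by case: d => [b|] /=; rewrite psubst_inner. Qed.

Lemma pull_outer d :
  pull d 'X = if d is Some c then 'X%:P * ('X + c%:P%:P) else 'X.
Proof. by case: d => [b|] /=; rewrite psubst_outer. Qed.

(* The exceptional curve of [d] becomes the zero locus of the outer variable. *)
Definition exc_outer d M : {poly {poly F}} := if d is Some _ then swapXY M else M.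

Lemma exc_outer_is_zmod_morphism d : zmod_morphism (exc_outer d).
Proof. by case: d => [c|] G H //=; rewrite rmorphB. Qed.

Lemma exc_outer_is_monoid_morphism d : monoid_morphism (exc_outer d).
Proof. by case: d => [c|]; split=> // [|G H] /=; rewrite ?rmorph1 ?rmorphM. Qed.

HB.instance Definition _ d := GRing.isZmodMorphism.Build
  {poly {poly F}} {poly {poly F}} (exc_outer d) (exc_outer_is_zmod_morphism d).
HB.instance Definition _ d := GRing.isMonoidMorphism.Build
  {poly {poly F}} {poly {poly F}} (exc_outer d) (exc_outer_is_monoid_morphism d).

Lemma exc_outerK d : involutive (exc_outer d).
Proof. by case: d => [c|] M //=; rewrite swapXYK. Qed.

Lemma exc_outer_exc d : exc_outer d (exc d) = 'X.
Proof. by case: d => [c|] //=; rewrite swapXY_Y. Qed.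

(** Restriction to the exceptional curve, in its remaining coordinate: after [exc_outer] that curve
    is the zero locus of the outer variable. *)
Definition restr d M : {poly F} := (exc_outer d M)`_0.

Lemma restr_is_zmod_morphism d : zmod_morphism (restr d).
Proof. by move=> G H; rewrite /restr rmorphB coefB. Qed.

Lemma restr_is_monoid_morphism d : monoid_morphism (restr d).
Proof.
by split=> [|G H]; rewrite /restr ?rmorph1 ?coef1 // rmorphM -!horner_coef0 hornerM.
Qed.

HB.instance Definition _ d := GRing.isZmodMorphism.Build
  {poly {poly F}} {poly F} (restr d) (restr_is_zmod_morphism d).
HB.instance Definition _ d := GRing.isMonoidMorphism.Build
  {poly {poly F}} {poly F} (restr d) (restr_is_monoid_morphism d).

Lemma restrB d G H : restr d (G - H) = restr d G - restr d H.
Proof. exact: restr_is_zmod_morphism. Qed.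

Lemma restrD d G H : restr d (G + H) = restr d G + restr d H.
Proof. exact: raddfD. Qed.

Lemma restrM d G H : restr d (G * H) = restr d G * restr d H.
Proof. by case: (restr_is_monoid_morphism d). Qed.

Lemma restrX d G n : restr d (G ^+ n) = restr d G ^+ n.
Proof. exact: rmorphXn. Qed.

Lemma restr_nat d n : restr d n%:R = n%:R.
Proof. exact: rmorph_nat. Qed.

Lemma restr1 d : restr d 1 = 1.
Proof. exact: rmorph1. Qed.

Lemma restr_const d c : restr d c%:P%:P = c%:P.
Proof.
by case: d => [b|]; rewrite /restr /= ?swapXY_polyC ?map_polyC /= coefC.
Qed.

Lemma restr_inner d : restr d 'X%:P = if d is Some _ then 0 else 'X.
Proof.
by case: d => [b|]; rewrite /restr /= ?swapXY_Y ?coefX // coefC.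
Qed.

Lemma restr_outer d : restr d 'X = if d is Some _ then 'X else 0.
Proof.
by case: d => [b|]; rewrite /restr /= ?swapXY_X ?coefX // coefC.
Qed.

Lemma restr_exc d : restr d (exc d) = 0.
Proof. by rewrite /restr exc_outer_exc coefX. Qed.

Lemma restr_eq0 d M : restr d M = 0 <-> exists Q, M = exc d * Q.
Proof.
split=> [M0|[Q ->]]; last by rewrite rmorphM /= restr_exc mul0r.
have /factor_theorem[Q MQ] : root (exc_outer d M) 0.
  by rewrite rootE horner_coef0; apply/eqP.
exists (exc_outer d Q); rewrite -[M](exc_outerK d) MQ subr0 rmorphM mulrC /=.
by rewrite -(exc_outer_exc d) exc_outerK.
Qed.

End Pull.

(** * Homogeneous forms and multiplicity under a blow-up *)

Section Cones.

Variable F : fieldType.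
Implicit Types (A B G H M : {poly {poly F}}) (d : P1 F).

(* The homogeneous part of degree [n], dehomogenized at [u = 1]. *)
Definition cone G n : {poly F} := \poly_(j < n.+1) G`_j`_(n - j).

(** The degree [n] form of [G] evaluated at [(1, v + c)], respectively at [(u, 1)]; the latter
    reverses the order of the coefficients of [cone]. *)
Definition pull_coef d G n : {poly F} :=
  if d is Some c then cone G n \Po ('X + c%:P)
  else \poly_(i < n.+1) G`_(n - i)`_i.

Lemma sum_monomials_of_degree G (K : nat -> nat -> {poly F}) n :
  \sum_(j < size G) \sum_(i < size G`_j) (G`_j`_i *: K i j) *+ (n == i + j)%N
    = \sum_(j < n.+1) G`_j`_(n - j) *: K (n - j)%N j.
Proof.
have inner j : \sum_(i < size G`_j) (G`_j`_i *: K i j) *+ (n == i + j)%N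
    = if (j <= n)%N then G`_j`_(n - j) *: K (n - j)%N j else 0.
  case: leqP => [le_jn|lt_nj]; last first.
    rewrite big1 // => i _; rewrite (_ : (_ == _) = false) //.
    by apply/eqP; lia.
  have [lt_s|le_s] := ltnP (n - j) (size G`_j).
    rewrite (bigD1 (Ordinal lt_s)) //= subnK // eqxx mulr1n big1 ?addr0 // => i.
    move=> /eqP ne_i; rewrite (_ : (_ == _) = false) //.
    by apply/eqP => e; apply: ne_i; apply/val_inj => /=; lia.
  rewrite (nth_default _ le_s) scale0r big1 // => i _.
  rewrite (_ : (_ == _) = false) //.
  by apply/eqP => e; have := ltn_ord i; lia.
rewrite (eq_bigr _ (fun j _ => inner (nat_of_ord j))).
rewrite -(big_mkord xpredT
  (fun j => if (j <= n)%N then G`_j`_(n - j) *: K (n - j)%N j else 0)).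
rewrite -(big_mkord xpredT (fun j => G`_j`_(n - j) *: K (n - j)%N j)).
(* Both ranges are widened to a common bound: indices past [size G] give default zero coefficients,
   those past [n] are cut by the test. *)
set N := maxn (size G) n.+1.
rewrite (big_nat_widen _ _ N) ?leq_maxl // [RHS](big_nat_widen _ _ N) ?leq_maxr //.
rewrite big_mkcond [RHS]big_mkcond /=; apply: eq_bigr => j _.
rewrite ltnS; case: ifP => [//|/negbT]; rewrite -leqNgt => le_s.
by rewrite (nth_default _ le_s) coef0 scale0r if_same.
Qed.

(** A monomial of total degree [n] pulls back to the [n]-th power of the exceptional equation times
    a polynomial in the other coordinate. *)
Lemma coef_pull d G n : (exc_outer d (pull d G))`_n = pull_coef d G n.
Proof.
case: d => [c|] /=.
  rewrite /psubst raddf_sum coef_sum.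
  transitivity (\sum_(j < size G) \sum_(i < size G`_j)
     (G`_j`_i *: ('X + c%:P) ^+ j) *+ (n == i + j)%N).
    apply: eq_bigr => j _; rewrite raddf_sum coef_sum; apply: eq_bigr => i _.
    rewrite /= !rmorphM !rmorphXn rmorphM rmorphD /= !swapXY_polyC !map_polyC /=.
    rewrite swapXY_X map_polyX -polyCD exprMn -polyC_exp mulrA -(mulrA _ 'X^i).
    by rewrite -exprD coefMC coefCM coefXn mulrAC mul_polyC mulr_natr.
  rewrite (sum_monomials_of_degree G (fun i j => ('X + c%:P) ^+ j)).
  rewrite /cone poly_def rmorph_sum /=; apply: eq_bigr => j _.
  by rewrite comp_polyZ rmorphXn /= comp_polyX.
rewrite /psubst coef_sum.
transitivity (\sum_(j < size G) \sum_(i < size G`_j)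
     (G`_j`_i *: 'X ^+ i) *+ (n == i + j)%N).
  apply: eq_bigr => j _; rewrite coef_sum; apply: eq_bigr => i _.
  rewrite exprMn -polyC_exp -mulrA -mulrA -exprD mulrA -polyCM coefCM coefXn.
  by rewrite mul_polyC mulr_natr.
rewrite (sum_monomials_of_degree G (fun i j => 'X ^+ i)).
rewrite poly_def -(big_mkord xpredT (fun j => G`_j`_(n - j) *: 'X^(n - j))).
rewrite big_nat_rev /= big_mkord; apply: eq_bigr => i _.
by rewrite add0n subSS subKn // -ltnS.
Qed.

Lemma coef_cone G n j : (j <= n)%N -> (cone G n)`_j = G`_j`_(n - j).
Proof. by move=> le_jn; rewrite coef_poly ltnS le_jn. Qed.

(** Translation by [c] and reversal of coefficients are injective on forms of degree [n]; hence the
    multiplicity is the same in all charts. *)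
Lemma pull_coef_eq0 d G n : (pull_coef d G n == 0) = (cone G n == 0).
Proof.
case: d => [c|] /=; first by rewrite comp_poly_eq0 // size_XaddC.
apply/eqP/eqP => /polyP G0; apply/polyP => i; rewrite coef_poly coef0 ltnS.
  case: leqP => // le_in; have := G0 (n - i)%N.
  by rewrite coef_poly coef0 ltnS leq_subr subKn.
case: leqP => // le_in; have := G0 (n - i)%N.
by rewrite coef_poly coef0 ltnS leq_subr subKn.
Qed.

Lemma pull_inj d : injective (pull d).
Proof.
move=> G H eqGH; apply/eqP; rewrite -subr_eq0; apply/eqP.
have cone0 n : cone (G - H) n = 0.
  apply/eqP; rewrite -(pull_coef_eq0 d) -coef_pull raddfB /= eqGH subrr.
  by rewrite raddf0 coef0.
apply/polyP => j; apply/polyP => i; rewrite !coef0.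
by have := coef_cone (G - H) (leq_addl i j); rewrite cone0 coef0 addnK.
Qed.

Lemma pull_eq0 d G : (pull d G == 0) = (G == 0).
Proof. by rewrite -[RHS](inj_eq (@pull_inj d)) raddf0. Qed.

Lemma exc_neq0 d : exc d != 0.
Proof.
apply/eqP => /(congr1 (exc_outer d)); rewrite exc_outer_exc raddf0.
by apply/eqP; rewrite polyX_eq0.
Qed.

Lemma cone_of_pull d G m G1 : pull d G = exc d ^+ m * G1 ->
  (forall n, (n < m)%N -> cone G n = 0) /\
  (forall n, pull_coef d G (n + m) = (exc_outer d G1)`_n).
Proof.
move=> pullG; have coefG n : pull_coef d G n =
    if (n < m)%N then 0 else (exc_outer d G1)`_(n - m).
  by rewrite -coef_pull pullG rmorphM rmorphXn /= exc_outer_exc coefXnM.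
split=> n; last by rewrite coefG ltnNge leq_addl addnK.
by move=> lt_nm; apply/eqP; rewrite -(pull_coef_eq0 d) coefG lt_nm.
Qed.

(** Dropping the first [m] coefficients divides by the exceptional equation. Together with
    [cone_of_pull], this carries a multiplicity found in one direction over to any other. *)
Lemma pull_of_cone d G m : (forall n, (n < m)%N -> cone G n = 0) ->
  exists2 G1, pull d G = exc d ^+ m * G1 & restr d G1 = pull_coef d G m.
Proof.
move=> mG; exists (exc_outer d (drop_poly m (exc_outer d (pull d G)))).
  apply: (can_inj (exc_outerK d)); rewrite rmorphM rmorphXn /= exc_outer_exc exc_outerK.
  rewrite -[LHS](poly_take_drop m) mulrC -[RHS]add0r; congr (_ + _).
  apply/polyP => n; rewrite coef_take_poly coef0 coef_pull; case: ifP => // lt_nm.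
  by apply/eqP; rewrite pull_coef_eq0 mG.
by rewrite /restr exc_outerK coef_drop_poly add0n coef_pull.
Qed.

(* The linear form vanishing in the direction [d], dehomogenized at [u = 1]:
   for [d = None] this is the form [u] itself. *)
Definition axis d : {poly F} := if d is Some c then 'X - c%:P else 1.

(** The restriction hypothesis says that the strict transform can meet the exceptional curve only at
    [d]; undoing the translation or the reversal recovers the tangent cone. *)
Lemma cone_of_restr d G m G1 lambda :
    pull d G = exc d ^+ m * G1 -> restr d G1 = lambda *: 'X^m ->
  cone G m = lambda *: axis d ^+ m.
Proof.
move=> /cone_of_pull[_ /(_ 0%N)]; rewrite add0n -/(restr d G1) => coneG restrG.
case: d => [c|] /= in coneG restrG *; move: coneG; rewrite restrG.
  move=> /(congr1 (fun p => p \Po ('X - c%:P))); rewrite comp_polyXaddC_K => ->.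
  by rewrite comp_polyZ rmorphXn /= comp_polyX.
move=> /polyP coneG; apply/polyP => j; rewrite expr1n coefZ coef1 coef_poly ltnS.
case: leqP => [le_jm|]; last by case: j => //= *; rewrite mulr0.
have := coneG (m - j)%N.
rewrite coef_poly ltnS leq_subr subKn // coefZ coefXn => ->; congr (_ * _%:R).
by congr (nat_of_bool _); apply/eqP/eqP; lia.
Qed.

End Cones.

(** * Power series and irreducibility *)

Section Series.

Variable F : fieldType.
Implicit Types (A B C P Q : series F) (G M : {poly {poly F}}).

Definition truncation N A : {poly {poly F}} := \poly_(j < N) \poly_(i < N) A i j.

Lemma coef_truncation N A i j :
  (i < N)%N -> (j < N)%N -> (truncation N A)`_j`_i = A i j.
Proof. by move=> lt_iN lt_jN; rewrite coef_poly lt_jN coef_poly lt_iN. Qed.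

(** A coefficient of a product depends only on coefficients of smaller or equal indices, so the laws
    of series can be read off polynomial truncations. *)
Lemma smul_coefM A B M M' i j :
    (forall k l, (k <= i)%N -> (l <= j)%N -> M`_l`_k = A k l) ->
    (forall k l, (k <= i)%N -> (l <= j)%N -> M'`_l`_k = B k l) ->
  (M * M')`_j`_i = smul A B i j.
Proof.
move=> MA MB; rewrite coefM coef_sum /smul.
under eq_bigr => l _ do rewrite coefM.
rewrite exchange_big; apply: eq_bigr => k _; apply: eq_bigr => l _ /=.
by rewrite MA ?MB ?leq_subr // -ltnS.
Qed.

Lemma smul_truncation N A B i j : (i < N)%N -> (j < N)%N ->
  (truncation N A * truncation N B)`_j`_i = smul A B i j.
Proof.
by move=> iN jN; apply: smul_coefM => k l ki lj; apply: coef_truncation;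
  apply: leq_ltn_trans; eassumption.
Qed.

Lemma smulC A B : smul A B =2 smul B A.
Proof.
move=> i j; set N := (maxn i j).+1.
have [iN jN] : (i < N)%N /\ (j < N)%N by rewrite !ltnS leq_maxl leq_maxr.
by rewrite -!(smul_truncation _ _ iN jN) mulrC.
Qed.

Lemma smulA A B C : smul A (smul B C) =2 smul (smul A B) C.
Proof.
move=> i j; set N := (maxn i j).+1.
have [iN jN] : (i < N)%N /\ (j < N)%N by rewrite !ltnS leq_maxl leq_maxr.
have small k l : (k <= i)%N -> (l <= j)%N -> (k < N)%N /\ (l < N)%N.
  by move=> ki lj; rewrite !(leq_ltn_trans ki, leq_ltn_trans lj).
rewrite -(@smul_coefM _ _ (truncation N A) (truncation N B * truncation N C)).
- rewrite mulrA; apply: smul_coefM => k l /small ki /ki[kN lN].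
    exact: smul_truncation.
  exact: coef_truncation.
- by move=> k l /small ki /ki[kN lN]; apply: coef_truncation.
by move=> k l /small ki /ki[kN lN]; apply: smul_truncation.
Qed.

Lemma eq_smul A A' B B' : A =2 A' -> B =2 B' -> smul A B =2 smul A' B'.
Proof.
move=> eA eB i j; apply: eq_bigr => k _; apply: eq_bigr => l _.
by rewrite eA eB.
Qed.

Lemma smul1s A : smul (sone F) A =2 A.
Proof.
move=> i j; rewrite /smul big_ord_recl big_ord_recl /= !subn0 mul1r.
by rewrite !big1 ?addr0 // => k _; rewrite ?big1 // => *; rewrite mul0r.
Qed.

Lemma smul_at0 A B : smul A B 0%N 0%N = A 0%N 0%N * B 0%N 0%N.
Proof. by rewrite /smul !big_ord1. Qed.

Section Inverse.

Variable A : series F.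
Hypothesis A0 : A 0%N 0%N != 0.

Let N : series F := fun i j => if (i == 0%N) && (j == 0%N) then 0 else A i j.

(** Fixed-point iteration for [B = (1 - N B) / a], where [a] is the constant term of [A] and [N] the
    rest; each step settles one more total degree. *)
Fixpoint inverse_approx n : series F :=
  if n is n'.+1 then
    fun i j => (sone F i j - smul N (inverse_approx n') i j) / A 0%N 0%N
  else fun _ _ => 0.

(** Since [N] has no constant term, this coefficient involves only coefficients of strictly smaller
    total degree in the second factor. *)
Lemma eq_smul_nilpotent B C i j :
    (forall k l, (k + l < i + j)%N -> B k l = C k l) ->
  smul N B i j = smul N C i j.
Proof.
move=> eBC; apply: eq_bigr => k _; apply: eq_bigr => l _.
rewrite /N; case: ifP => [_|nz]; first by rewrite !mul0r.
congr (_ * _); apply: eBC; have := ltn_ord k; have := ltn_ord l.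
by move: nz; lia.
Qed.

Lemma inverse_approx_stable n i j : (i + j < n)%N ->
  inverse_approx n i j = inverse_approx n.+1 i j.
Proof.
elim: n i j => // n IHn i j lt_n /=; congr ((_ - _) / _).
by apply: eq_smul_nilpotent => k l lt_kl; apply: IHn; lia.
Qed.

Let B : series F := fun i j => inverse_approx (i + j).+1 i j.

Lemma inverse_approx_limit n i j : (i + j < n)%N -> inverse_approx n i j = B i j.
Proof.
elim: n => // n IHn lt_n; have [lt_ijn|le] := ltnP (i + j) n.
  by rewrite -inverse_approx_stable ?IHn.
by have -> : n = (i + j)%N by lia.
Qed.

Lemma sunit_of_at0 : sunit A.
Proof.
exists B => i j.
have -> : smul A B i j = A 0%N 0%N * B i j + smul N B i j.
  rewrite /smul big_ord_recl [in RHS]big_ord_recl big_ord_recl.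
  rewrite [X in _ + (X + _)]big_ord_recl /= !subn0 {2}/N /= mul0r add0r.
  by rewrite -!addrA; congr (_ + (_ + _)).
rewrite /B /= mulrC divfK // (@eq_smul_nilpotent _ B) ?subrK // => k l lt_kl.
exact: inverse_approx_limit.
Qed.

End Inverse.

Lemma sunitP A : sunit A <-> A 0%N 0%N <> 0.
Proof.
split=> [[B AB] A0|/eqP]; last exact: sunit_of_at0.
by have := AB 0%N 0%N; rewrite smul_at0 A0 mul0r => /esym/eqP; rewrite oner_eq0.
Qed.

Definition factors A : Prop :=
  exists P Q, [/\ P 0%N 0%N = 0, Q 0%N 0%N = 0 & A =2 smul P Q].

Lemma sirreducibleP A : A 0%N 0%N = 0 -> ~ factors A -> sirreducible A.
Proof.
move=> A0 nfA; split=> [/sunitP//|P Q APQ].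
have [P0|P0] := eqVneq (P 0%N 0%N) 0; last by left; apply/sunitP/eqP.
have [Q0|Q0] := eqVneq (Q 0%N 0%N) 0; last by right; apply/sunitP/eqP.
by case: nfA; exists P, Q.
Qed.

Lemma branch_at_origin G B : branch G B -> at_origin G = 0.
Proof.
move=> [[nuB _] [Q GBQ]]; have: at_origin G = _ := GBQ 0%N 0%N; rewrite smul_at0 => ->.
case: (eqVneq (B 0%N 0%N) 0) => [->|/eqP B0]; first by rewrite mul0r.
by case: nuB; apply/sunitP.
Qed.

Lemma branch_of_irreducible G :
  sirreducible (series_of_poly G) -> branch G (series_of_poly G).
Proof.
move=> irrG; split=> //; exists (sone F) => i j.
by rewrite smulC smul1s.
Qed.

(** [B] is not a unit, so irreducibility makes its cofactor a unit, whose inverse gives the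
    association. *)
Lemma branch_unique G B :
  sirreducible (series_of_poly G) -> branch G B -> sassoc B (series_of_poly G).
Proof.
move=> [_ irrG] [[nuB _] [Q GBQ]]; case: (irrG _ _ GBQ) => // -[U QU].
exists U; first by exists Q => i j; rewrite smulC QU.
move=> i j; rewrite -[LHS]smul1s.
rewrite -(eq_smul QU (fun _ _ => erefl)) -(eq_smul (smulC _ _) (fun _ _ => erefl)).
rewrite -smulA; apply: eq_smul => // k l.
by rewrite GBQ smulC.
Qed.

(** A product of two series without constant term has no linear part. *)
Lemma smooth_irreducible G :
  at_origin G = 0 -> G`_1`_0 != 0 -> sirreducible (series_of_poly G).
Proof.
move=> G0 /eqP G1; apply: sirreducibleP => // -[P [Q [P0 Q0 GPQ]]].
apply: G1; have := GPQ 0%N 1%N; rewrite /series_of_poly /smul big_ord1 => ->.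
by rewrite big_ord_recl big_ord1 /= P0 Q0 mul0r mulr0 addr0.
Qed.

Definition form A n : {poly F} := \poly_(j < n.+1) A (n - j)%N j.

(** In the chart [Some 0] the cones are the coefficients of the pull-back, which is a ring
    morphism. *)
Lemma cone_mul M M' n :
  cone (M * M') n = \sum_(k < n.+1) cone M k * cone M' (n - k).
Proof.
have coneE G k : cone G k = (exc_outer (Some 0 : P1 F) (pull (Some 0) G))`_k.
  by rewrite coef_pull /= polyC0 addr0 comp_polyXr.
by rewrite coneE !rmorphM coefM; apply: eq_bigr => k _; rewrite !coneE.
Qed.

Lemma form_smul P Q n :
  form (smul P Q) n = \sum_(k < n.+1) form P k * form Q (n - k).
Proof.
have formE A k : (k < n.+1)%N -> form A k = cone (truncation n.+1 A) k.
  move=> lt_k; apply/polyP => j; rewrite !coef_poly; case: ifP => // lt_jk.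
  rewrite (leq_trans lt_jk lt_k) coef_poly (_ : (_ < _)%N) //.
  by apply: leq_ltn_trans lt_k; apply: leq_subr.
transitivity (cone (truncation n.+1 P * truncation n.+1 Q) n).
  apply/polyP => j; rewrite !coef_poly; case: ifP => // lt_jn.
  by rewrite smul_truncation // ltnS leq_subr.
rewrite cone_mul; apply: eq_bigr => k _; rewrite !formE //.
by rewrite ltnS leq_subr.
Qed.

(* A tangent cone supported on one line forces both factors through the same
   infinitely near point, so a factorization survives the blow-up. *)
Lemma factors_strict A A' m c lambda : lambda != 0 ->
    (forall n, (n < m)%N -> form A n = 0) -> form A m = lambda *: ('X - c%:P) ^+ m ->
    (forall n l, A' n l = (form A (n + m) \Po ('X + c%:P))`_l) ->
  factors A -> factors A'.
Proof.
move=> lam0 lowA topA A'E [P [Q [P0 Q0 APQ]]].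
have formA n : form A n = \sum_(k < n.+1) form P k * form Q (n - k).
  rewrite -form_smul; apply/polyP => j; rewrite !coef_poly.
  by case: ifP => // _; rewrite APQ.
have topA0 : form A m != 0.
  by rewrite topA scaler_eq0 negb_or lam0 expf_neq0 // polyXsubC_eq0.
have [k0 /andP[Pk Qk]] : exists k : 'I_m.+1,
    (form P k != 0) && (form Q (m - k) != 0).
  apply/existsP; apply: contraNT topA0 => /existsPn PQ0.
  rewrite formA big1 // => k _; apply/eqP; rewrite mulf_eq0.
  by have := PQ0 k; rewrite negb_and !negbK.
(* [p] and [q] are the orders of [P] and [Q]; the order is additive, so they will sum to [m]. *)
case: (ex_minnP (ex_intro (fun n => form P n != 0) _ Pk)) => p Pp minP.
case: (ex_minnP (ex_intro (fun n => form Q n != 0) _ Qk)) => q Qq minQ.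
have lowP n : (n < p)%N -> form P n = 0.
  by move=> lt_np; apply/eqP; apply: contraTT lt_np => /minP; rewrite leqNgt.
have lowQ n : (n < q)%N -> form Q n = 0.
  by move=> lt_nq; apply/eqP; apply: contraTT lt_nq => /minQ; rewrite leqNgt.
have formA_shift n : form A (n + (p + q)) =
    \sum_(k < n.+1) form P (k + p) * form Q (n - k + q).
  rewrite formA -(big_mkord xpredT (fun k => form P k * form Q (n + (p + q) - k))).
  rewrite (@big_cat_nat _ _ _ p) //=; last by lia.
  rewrite (@big_cat_nat _ _ _ (n + p).+1 p) //=; try lia.
  rewrite big_nat_cond big1 ?add0r; last first.
    by move=> k /andP[/andP[_ lt_kp] _]; rewrite lowP ?mul0r.
  rewrite [X in _ + X]big_nat_cond [X in _ + X]big1 ?addr0; last first.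
    by move=> k /andP[/andP[lt_k lt_k'] _]; rewrite lowQ ?mulr0 //; lia.
  rewrite -addSn -{1}(add0n p) big_addn addnK big_mkord; apply: eq_bigr => k _.
  by congr (_ * form Q _); have := ltn_ord k; lia.
have formA_pq : form A (p + q) = form P p * form Q q.
  by rewrite -[(p + q)%N]add0n formA_shift big_ord1 !add0n.
have m_pq : m = (p + q)%N.
  apply/eqP; rewrite eqn_leq; apply/andP; split.
    rewrite leqNgt; apply/negP => /lowA /eqP.
    by rewrite formA_pq mulf_eq0 (negPf Pp) (negPf Qq).
  rewrite leqNgt; apply: contra topA0 => lt_m; rewrite formA big1 // => j _.
  have [lt_jp|le_pj] := ltnP j p; first by rewrite lowP ?mul0r.
  by have lt_j := ltn_ord j; rewrite lowQ ?mulr0 //; lia.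
have size_form B n : (size (form B n) <= n.+1)%N by apply: size_poly.
have form0 B : form B 0 = (B 0%N 0%N)%:P.
  by apply/polyP => j; rewrite coef_poly coefC; case: j.
have p_gt0 : (0 < p)%N.
  by rewrite lt0n; apply: contra Pp => /eqP ->; rewrite form0 P0.
have q_gt0 : (0 < q)%N.
  by rewrite lt0n; apply: contra Qq => /eqP ->; rewrite form0 Q0.
have prodE : form P p * form Q q = lambda *: ('X - c%:P) ^+ m.
  by rewrite -formA_pq -m_pq topA.
(* The product has full degree [p + q] and each initial form has degree at most its order, so both
   attain it. Each is then a constant times a power of ['X - c%:P]. *)
have size_prod : (size (form P p) + size (form Q q) = m.+2)%N.
  have := size_mul Pp Qq; rewrite prodE size_scale // size_exp_XsubC.
  move: Pp; rewrite -size_poly_gt0; move: (size (form P p)) (size (form Q q)).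
  by move=> a b; lia.
have [sizeP sizeQ] : size (form P p) = p.+1 /\ size (form Q q) = q.+1.
  move: (size_form P p) (size_form Q q) size_prod.
  by move: (size (form P p)) (size (form Q q)) => a b; lia.
have root_of g h n : g * h = lambda *: ('X - c%:P) ^+ m -> size g = n.+1 ->
    (0 < n)%N -> g.[c] = 0.
  move=> gh size_g n_gt0.
  have /dvdp_exp_XsubCP[k' _ gk] : g %| ('X - c%:P) ^+ m.
    by rewrite -(dvdpZr _ _ lam0) -gh dvdp_mulIl.
  have k'n : k' = n by have := eqp_size gk; rewrite size_g size_exp_XsubC => -[].
  apply/eqP; rewrite -rootE -dvdp_XsubCl (eqp_dvdr _ gk) k'n -(prednK n_gt0).
  by rewrite exprS dvdp_mulIl.
(* The factors are the strict transforms of [P] and [Q] at direction [c]; their constant terms are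
   the values at [c] of the initial forms. *)
exists (fun n l => (form P (n + p) \Po ('X + c%:P))`_l).
exists (fun n l => (form Q (n + q) \Po ('X + c%:P))`_l).
have at0 g : (g \Po ('X + c%:P))`_0 = g.[c].
  by rewrite -horner_coef0 horner_comp !hornerE.
split=> [||n l].
- by rewrite at0 add0n (root_of _ _ p prodE).
- rewrite at0 add0n; apply: (root_of _ (form P p) q) => //.
  by rewrite mulrC.
rewrite A'E m_pq formA_shift rmorph_sum coef_sum; apply: eq_bigr => k' _.
by rewrite rmorphM coefM.
Qed.

Definition sswap A : series F := fun i j => A j i.

Lemma factors_sswap A : factors A -> factors (sswap A).
Proof.
move=> [P [Q [P0 Q0 APQ]]]; exists (sswap P), (sswap Q); split=> // i j.
by rewrite /sswap APQ /smul exchange_big.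
Qed.

(** Direction [None] reduces to [Some 0] by exchanging the two coordinates. *)
Lemma factors_pull d G m G1 lambda : lambda != 0 ->
    pull d G = exc d ^+ m * G1 -> restr d G1 = lambda *: 'X^m ->
  factors (series_of_poly G) -> factors (series_of_poly G1).
Proof.
move=> lam0 pullG restrG factG.
have [lowG highG] := cone_of_pull pullG.
case: d => [c|] in pullG restrG highG *.
  apply: (factors_strict lam0 lowG (cone_of_restr pullG restrG) _ factG).
  by move=> n l; have /= := highG n; rewrite /form => ->; rewrite coef_swapXY.
have formG n : form (sswap (series_of_poly G)) n = pull_coef None G n by [].
have e : form (sswap (series_of_poly G)) m = lambda *: ('X - 0%:P) ^+ m.
  by have := highG 0%N; rewrite add0n formG polyC0 subr0 -restrG.
apply: (@factors_sswap (sswap (series_of_poly G1))).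
apply: (factors_strict lam0 _ e _ (factors_sswap factG)).
  move=> n lt_nm; rewrite formG; apply/eqP.
  by rewrite pull_coef_eq0 lowG.
by move=> n l; rewrite formG highG polyC0 addr0 comp_polyXr.
Qed.

End Series.

(** * Resolution of a pencil along a chain of points *)

Arguments pull : simpl never.

Section Towers.

Variable F : fieldType.
Implicit Types (A B C G H M R W : {poly {poly F}}) (d : P1 F) (q s : ipoint F).

Lemma at_origin_restr d M : at_origin M = (restr d M)`_0.
Proof. by case: d => [c|]; rewrite /restr /= ?coef_swapXY. Qed.

Lemma at_origin_is_zmod_morphism : zmod_morphism (@at_origin F).
Proof. by move=> G H; rewrite /at_origin !coefB. Qed.

Lemma at_origin_is_monoid_morphism : monoid_morphism (@at_origin F).
Proof.
by split=> [|G H]; rewrite /at_origin ?coef1 // -!horner_coef0 !hornerM.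
Qed.

HB.instance Definition _ := GRing.isZmodMorphism.Build
  {poly {poly F}} F (@at_origin F) at_origin_is_zmod_morphism.
HB.instance Definition _ := GRing.isMonoidMorphism.Build
  {poly {poly F}} F (@at_origin F) at_origin_is_monoid_morphism.

Lemma at_originB G H : at_origin (G - H) = at_origin G - at_origin H.
Proof. exact: at_origin_is_zmod_morphism. Qed.

Lemma at_originD G H : at_origin (G + H) = at_origin G + at_origin H.
Proof. exact: raddfD. Qed.

Lemma at_originM G H : at_origin (G * H) = at_origin G * at_origin H.
Proof. by case: at_origin_is_monoid_morphism. Qed.

Lemma at_originX G n : at_origin (G ^+ n) = at_origin G ^+ n.
Proof. exact: rmorphXn. Qed.

Lemma at_origin1 : at_origin (1 : {poly {poly F}}) = 1.
Proof. exact: rmorph1. Qed.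

Lemma at_origin_nat n : at_origin (n%:R : {poly {poly F}}) = n%:R.
Proof. exact: rmorph_nat. Qed.

Lemma at_origin_inner : at_origin ('X%:P : {poly {poly F}}) = 0.
Proof. by rewrite /at_origin coefC coefX. Qed.

Lemma at_origin_outer : at_origin ('X : {poly {poly F}}) = 0.
Proof. by rewrite /at_origin coefX coef0. Qed.

Lemma at_origin_const (c : F) : at_origin c%:P%:P = c.
Proof. by rewrite /at_origin !coefC. Qed.

Lemma at_origin_exc d : at_origin (exc d) = 0.
Proof. by case: d => [c|]; rewrite ?at_origin_inner ?at_origin_outer. Qed.

(** The blow-up contracts the exceptional curve to the origin. *)
Lemma restr_pull d M : restr d (pull d M) = (at_origin M)%:P.
Proof.
have cone0 : cone M 0 = (at_origin M)%:P.
  by apply/polyP => j; rewrite coef_poly coefC; case: j.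
rewrite /restr coef_pull; case: d => [c|] /=; first by rewrite cone0 comp_polyC.
by rewrite -cone0; apply/polyP => i; rewrite !coef_poly; case: i.
Qed.

Lemma at_origin_pull d M : at_origin (pull d M) = at_origin M.
Proof. by rewrite (at_origin_restr d) restr_pull coefC. Qed.

Lemma restr_map_poly c M : map_poly (horner_eval 0) M = restr (Some c) M.
Proof.
apply/polyP => j; rewrite coef_map /restr /= /horner_eval horner_coef0.
by rewrite coef_swapXY.
Qed.

Local Notation total := Defs.total.

Lemma total_cons d q G : total (d :: q) G = total q (pull d G).
Proof. by []. Qed.

Lemma totalM q G H : total q (G * H) = total q G * total q H.
Proof. by elim: q G H => [//|d q IHq] G H; rewrite !total_cons rmorphM IHq. Qed.

Lemma total_eq0 q G : (total q G == 0) = (G == 0).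
Proof. by elim: q G => [//|d q IHq] G; rewrite total_cons IHq pull_eq0. Qed.

(** The common factor [exc d ^+ m] cancels, so the pencil may be followed on the quotients [G1] and
    [H1]. *)
Lemma total_strict d q G H m G1 H1 A B :
    pull d G = exc d ^+ m * G1 -> pull d H = exc d ^+ m * H1 ->
  A * total (d :: q) H = B * total (d :: q) G <-> A * total q H1 = B * total q G1.
Proof.
move=> pullG pullH; rewrite !total_cons pullG pullH !totalM !(mulrCA _ (total q _)).
split=> [|-> //]; apply: mulfI.
by rewrite total_eq0 expf_neq0 // exc_neq0.
Qed.

(** [G] has multiplicity [m] with tangent cone a power of the axis of [d]. On the new curve the
    pencil is constant: infinite if [mu = 0], and otherwise equal to [tau]. *)
Definition blowup_step (tau : F) d G H G1 H1 : Prop :=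
  exists (m : nat) (lambda mu : F),
    [/\ pull d G = exc d ^+ m * G1, pull d H = exc d ^+ m * H1,
        restr d G1 = lambda *: 'X^m, restr d H1 = mu *: 'X^m
      & lambda != 0 /\ (mu = 0 \/ lambda = tau * mu)].

(* Along [s] the base point of the pencil stays at the origin; the last
   exceptional curve is dicritical of degree 1, and [tau] is the value of the
   pencil at its intersection with the other components. *)
Fixpoint tower (tau : F) s G H : Prop :=
  if s is d :: s' then
    exists G1 H1, blowup_step tau d G H G1 H1 /\ tower tau s' G1 H1
  else
    exists R W, [/\ G = 'X + 'X%:P * R, H = 'X%:P * W,
                    at_origin W != 0 & at_origin R = tau * at_origin W].

Lemma defined_at_cons d q G H m G1 H1 :
    pull d G = exc d ^+ m * G1 -> pull d H = exc d ^+ m * H1 ->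
  defined_at G H (d :: q) <-> defined_at G1 H1 q.
Proof.
move=> pullG pullH.
by split=> -[A [B [AB ne0]]]; exists A, B; split=> //;
  move: AB; rewrite (total_strict _ _ _ pullG pullH).
Qed.

Lemma indeterminate_pull d G H m G1 H1 :
    pull d G = exc d ^+ m * G1 -> pull d H = exc d ^+ m * H1 ->
  defined_at G H [::] -> defined_at G1 H1 [::].
Proof.
move=> pullG pullH [A [B [/= AB ne0]]]; exists (pull d A), (pull d B).
rewrite !at_origin_pull; split=> //=.
move: (congr1 (pull d) AB); rewrite !rmorphM /= pullG pullH !(mulrCA (pull d _)).
by apply: mulfI; rewrite expf_neq0 // exc_neq0.
Qed.

(** If the pencil were defined at some point of the chain it would still be defined at the last one.
    There, [A u W = B (v + u R)] with [W] a unit makes both [A] and [B] vanish at the origin. *)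
Lemma tower_indeterminate tau s G H q :
  tower tau s G H -> prefix q s -> ~ defined_at G H q.
Proof.
elim: s q G H => [|d s IHs] q G H.
  case: q => // -[R [W [-> -> W0 _]]] _ [A [B [/= AB ne0]]].
  have /restr_eq0[B' B_exc] : restr (Some 0) B = 0.
    have /esym/eqP := congr1 (restr (Some 0)) AB.
    rewrite !rmorphM rmorphD rmorphM /= restr_inner restr_outer !mul0r mulr0 addr0.
    by rewrite mulf_eq0 polyX_eq0 orbF => /eqP.
  have X0 : ('X%:P : {poly {poly F}}) != 0 := exc_neq0 (Some 0).
  have : A * W = B' * ('X + 'X%:P * R).
    by apply: (mulfI X0); rewrite mulrCA AB B_exc mulrA.
  move=> /(congr1 (@at_origin F)); rewrite !rmorphM rmorphD rmorphM /=.
  rewrite at_origin_inner at_origin_outer mul0r addr0 mulr0 => /eqP.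
  rewrite mulf_eq0 (negPf W0) orbF => /eqP A0.
  by case: ne0; rewrite ?A0 ?B_exc ?rmorphM /= ?at_origin_inner ?mul0r eqxx.
move=> [G1 [H1 [[m [lambda [mu [pullG pullH _ _ _]]]] towerG1]]].
case: q => [|d' q] pre.
  by move=> /(indeterminate_pull pullG pullH); apply: IHs towerG1 _; apply: prefix0s.
move: pre; rewrite prefix_cons => /andP[/eqP -> pre].
by rewrite (defined_at_cons q pullG pullH); apply: IHs towerG1 pre.
Qed.

Lemma coef_axis_exp d m : (axis d ^+ m)`_m = if d is Some _ then 1 else (m == 0%N)%:R.
Proof.
case: d => [c|] /=; last by rewrite expr1n coef1.
have := monic_exp m (monicXsubC c); rewrite monicE lead_coefE size_exp_XsubC.
by move/eqP.
Qed.

(** The tangent cone is a power of the axis of [d], which does not vanish in the direction [d']; the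
    strict transform misses that point. *)
Lemma separated_direction d d' G m G1 lambda : lambda != 0 -> d' != d ->
    pull d G = exc d ^+ m * G1 -> restr d G1 = lambda *: 'X^m ->
  exists2 G', pull d' G = exc d' ^+ m * G' & at_origin G' != 0.
Proof.
move=> lam0 neq_d pullG restrG.
have [G' pullG' restrG'] := pull_of_cone d' (proj1 (cone_of_pull pullG)).
exists G' => //; rewrite (at_origin_restr d') restrG'.
have coneG := cone_of_restr pullG restrG.
case: d' => [c'|] in neq_d {pullG' restrG'} *; rewrite /=.
  rewrite -horner_coef0 horner_comp !hornerE coneG hornerZ horner_exp.
  rewrite mulf_neq0 // expf_neq0 //; case: d neq_d {pullG restrG coneG} => [c|] neq_d.
    rewrite /= hornerXsubC subr_eq0; apply: contra neq_d => /eqP ->; exact: eqxx.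
  by rewrite /= hornerC oner_eq0.
rewrite coef_poly /= subn0.
have := coef_cone G (leqnn m); rewrite subnn => <-; rewrite coneG coefZ coef_axis_exp.
by case: d neq_d {pullG restrG coneG} => [c|] //; rewrite mulr1.
Qed.

(** Where a point leaves the chain before its end, the numerator is a unit by [separated_direction].
    Above the last point a factor cancels and leaves a unit denominator for [Some c], a unit
    numerator for [None]. *)
Lemma tower_determinate tau s G H q d :
    tower tau s G H -> prefix q s -> ~~ prefix (rcons q d) s ->
  defined_at G H (rcons q d).
Proof.
elim: s q G H => [|e s IHs] q G H.
  case: q => // -[R [W [-> -> W0 _]]] _ _ /=.
  case: d => [c|].
    exists ('X + c%:P%:P + pull (Some c) R), (pull (Some c) W); split; last first.
      by right; rewrite at_origin_pull.
    rewrite !total_cons !rmorphD !rmorphM /= !pull_inner !pull_outer.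
    by ring.
  exists (1 + 'X%:P * pull None R), ('X%:P * pull None W); split; last first.
    by left; rewrite rmorphD rmorph1 rmorphM /= at_origin_inner mul0r addr0 oner_eq0.
  rewrite !total_cons !rmorphD !rmorphM /= !pull_inner !pull_outer.
  by ring.
move=> [G1 [H1 [[m [lambda [mu [pullG pullH restrG restrH [lam0 _]]]]] towerG1]]].
case: q => [|d' q].
  rewrite [rcons _ _]/= prefix_cons !prefix0s andbT => _ neq_d.
  have [G' pullG' G'0] := separated_direction lam0 neq_d pullG restrG.
  have [H' pullH' _] := pull_of_cone d (proj1 (cone_of_pull pullH)).
  by rewrite (defined_at_cons _ pullG' pullH'); exists G', H'; split; [rewrite mulrC|left].
rewrite prefix_cons rcons_cons prefix_cons => /andP[/eqP ->]; rewrite eqxx /=.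
by rewrite (defined_at_cons _ pullG pullH); apply: IHs.
Qed.

Definition prefixes s : seq (ipoint F) := [seq take i s | i <- iota 0 (size s).+1].

Lemma mem_prefixes s q : (q \in prefixes s) = prefix q s.
Proof.
apply/mapP/idP => [[i _ ->]|]; first exact: prefix_take.
move=> pre; exists (size q); last by move: pre; rewrite prefixE => /eqP.
by rewrite mem_iota ltnS size_prefix.
Qed.

Lemma prefix_of_rcons q d s : prefix (rcons q d) s -> prefix q s.
Proof. by rewrite -cats1; apply: catl_prefix. Qed.

Lemma tower_resolution tau s G H : tower tau s G H -> resolution G H (prefixes s).
Proof.
move=> towerG; split=> [q d|q []]; rewrite !mem_prefixes; first exact: prefix_of_rcons.
case/lastP: q => [|q d npre parent]; first by rewrite prefix0s.
by apply: tower_determinate towerG _ npre; rewrite -mem_prefixes (parent q d).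
Qed.

(** The chain resolves the pencil, and each of its points is indeterminate, so every resolution has
    to blow it up. *)
Lemma tower_minimal_resolution tau s G H K :
  tower tau s G H -> minimal_resolution G H K <-> K =i prefixes s.
Proof.
move=> towerG.
have minS K' : resolution G H K' -> {subset prefixes s <= K'}.
  move=> [_ defK'] q; rewrite mem_prefixes.
  (* A chain point outside [K'] has its parent in [K'] by induction, so it lies on the surface,
     where the pencil would be defined. *)
  elim/last_ind: q => [|q d IHq] pre; apply: contraPT (tower_indeterminate towerG pre);
    move=> nK; apply; apply: defK'; split=> // q' d'; first by case: q'.
  by move/rcons_inj => [<- _]; apply: IHq; apply: prefix_of_rcons pre.
have resS := tower_resolution towerG.
split=> [[resK minK] q|eqK].
  by apply/idP/idP; [apply: minK | apply: minS].
split; last by move=> K' /minS sub q; rewrite eqK; apply: sub.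
case: resS => blowS defS; split=> [q d|q [nq parent]].
  by rewrite !eqK; apply: blowS.
by apply: defS; split=> [|q' d' /parent]; rewrite -eqK.
Qed.

End Towers.

(** * Degree of the pencil on each exceptional curve, and uniqueness of strict transforms *)

Section Restrictions.

Variable F : fieldType.
Implicit Types (A B C G H M R W : {poly {poly F}}) (d : P1 F) (q s : ipoint F).
Implicit Types (a b : {poly F}) (t tau lambda mu : F) (K : seq (ipoint F)).
Local Notation total := Defs.total.

Lemma restriction_cons d q G H m G1 H1 a b :
    pull d G = exc d ^+ m * G1 -> pull d H = exc d ^+ m * H1 ->
  restriction G H (d :: q) a b <-> restriction G1 H1 q a b.
Proof.
move=> pullG pullH.
by split=> -[cop [A [B [k [AB k0 rA rB]]]]]; split=> //; exists A, B, k; split=> //;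
  move: AB; rewrite (total_strict _ _ _ pullG pullH).
Qed.

Lemma restriction_degree_cons d q G H m G1 H1 n :
    pull d G = exc d ^+ m * G1 -> pull d H = exc d ^+ m * H1 ->
  restriction_degree G H (d :: q) n <-> restriction_degree G1 H1 q n.
Proof.
by move=> pullG pullH; split=> -[ab rab ->]; exists ab => //;
  move: rab; rewrite (restriction_cons _ _ _ pullG pullH).
Qed.

Lemma size_coprime_dvd a b : coprimep a b -> a %| b -> size a = 1%N.
Proof.
by move=> cop ab; have := coprimep_dvdl ab cop; rewrite coprimepp => /eqP.
Qed.

(** [restriction] always reads the curve in the chart [Some 0], whatever [d] is. In that chart the
    two restrictions are [lambda] and [mu] times the same power of [axis d], which cancels. *)
Lemma restriction_blown_up_curve d G H m G1 H1 lambda mu a b : lambda != 0 ->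
    pull d G = exc d ^+ m * G1 -> pull d H = exc d ^+ m * H1 ->
    restr d G1 = lambda *: 'X^m -> restr d H1 = mu *: 'X^m ->
  restriction G H [::] a b -> lambda *: b = mu *: a.
Proof.
move=> lam0 pullG pullH restrG restrH [_ [A [B [k [AB k0]]]]].
rewrite !(restr_map_poly 0) => rA rB.
have [G' pullG' rG'] := pull_of_cone (Some 0) (proj1 (cone_of_pull pullG)).
have [H' pullH' rH'] := pull_of_cone (Some 0) (proj1 (cone_of_pull pullH)).
move: AB; rewrite (total_strict _ _ _ pullG' pullH') /=.
move=> /(congr1 (restr (Some 0))); rewrite !rmorphM /= rA rB rG' rH' /=.
rewrite polyC0 addr0 !comp_polyXr (cone_of_restr pullG restrG).
rewrite (cone_of_restr pullH restrH) -!mulrA => /(mulfI k0).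
rewrite -!scalerAr !scalerAl.
have axis0 : axis d ^+ m != 0.
  by rewrite expf_neq0 //; case: d {pullG pullH restrG restrH} => [c|];
    rewrite /= ?oner_eq0 ?polyXsubC_eq0.
by move=> /(mulIf axis0).
Qed.

Lemma size_proportional a b lambda mu : lambda != 0 -> coprimep a b ->
  lambda *: b = mu *: a -> size a = 1%N /\ (size b <= 1)%N.
Proof.
move=> lam0 cop ba; have bE : b = (lambda^-1 * mu) *: a.
  by rewrite -scalerA -ba scalerA mulVf // scale1r.
have a1 : size a = 1%N.
  by apply: size_coprime_dvd cop _; rewrite bE -mul_polyC dvdp_mull.
by split=> //; rewrite bE -a1 size_scale_leq.
Qed.

(** Only the last curve is dicritical: the boolean counts as degree 1 there and degree 0 on the
    earlier curves, where the pencil is constant. *)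
Lemma tower_restriction_degree tau s G H q n : tower tau s G H -> prefix q s ->
  restriction_degree G H q n -> n = (q == s).
Proof.
elim: s q G H => [|e s IHs] q G H.
  case: q => // -[R [W [-> -> W0 _]]] _ [[a b] /= [cop [A [B [k [AB k0 rA rB]]]]] ->].
  rewrite !(restr_map_poly 0) in rA rB.
  have e : A * pull (Some 0) W = B * ('X + pull (Some 0) R).
    apply: (mulfI (exc_neq0 (Some 0))); move: AB.
    rewrite [total _ _]/= [total _ _]/= !rmorphD !rmorphM /= !pull_inner !pull_outer.
    by rewrite !polyC0 => AB; ring: AB.
  move: e => /(congr1 (restr (Some 0))); rewrite !rmorphM rmorphD /= restr_outer.
  rewrite !restr_pull rA rB -!mulrA => /(mulfI k0) aE.
  (* Here [a] times the constant [W(0)] equals [b] times a monic linear polynomial; coprimality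
     makes [b] constant and [a] of degree 1. *)
  have b1 : size b = 1%N.
    apply: (@size_coprime_dvd b a); first by rewrite coprimep_sym.
    rewrite -(dvdpZr _ _ W0) -mul_polyC mulrC aE; exact: dvdp_mulIl.
  have : size (a * (at_origin W)%:P) = 2%N.
    rewrite aE size_mul ?b1 ?size_XaddC //; first by rewrite -size_poly_gt0 b1.
    by rewrite -size_poly_gt0 size_XaddC.
  by rewrite mulrC mul_polyC size_scale // b1 => ->.
move=> [G1 [H1 [[m [lambda [mu [pullG pullH restrG restrH [lam0 _]]]]] towerG1]]].
case: q => [|d' q].
  move=> _ [[a b] /= rab ->].
  have := restriction_blown_up_curve lam0 pullG pullH restrG restrH rab.
  case/(size_proportional lam0); first by case: rab.
  by move=> -> /maxn_idPl ->.
rewrite prefix_cons => /andP[/eqP -> pre].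
rewrite (restriction_degree_cons _ _ pullG pullH) => /(IHs _ _ _ towerG1 pre) ->.
by rewrite eqseq_cons eqxx.
Qed.

Lemma tower_dicritical tau s G H : tower tau s G H -> restriction_degree G H s 1.
Proof.
elim: s G H => [|e s IHs] G H.
  case=> [R [W [-> -> W0 _]]].
  exists ('X + (at_origin R)%:P, (at_origin W)%:P); last first.
    by rewrite /= size_XaddC size_polyC W0.
  split; first by rewrite /= -(alg_polyC (at_origin W)) coprimepZr ?coprimep1.
  exists ('X + pull (Some 0) R), (pull (Some 0) W), 1.
  rewrite !(restr_map_poly 0) rmorphD /= !restr_pull restr_outer oner_eq0 !mul1r.
  split=> //.
  rewrite /= !rmorphD !rmorphM /= !pull_inner !pull_outer.
  by rewrite !polyC0; ring.
move=> [G1 [H1 [[m [lambda [mu [pullG pullH _ _ _]]]] /IHs degG1]]].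
by rewrite (restriction_degree_cons _ _ pullG pullH).
Qed.

Lemma strict1_of_restr d G m G1 :
  pull d G = exc d ^+ m * G1 -> restr d G1 != 0 -> strict1 d G G1.
Proof.
move=> pullG /eqP rG1; split; first by exists m.
by move=> /restr_eq0.
Qed.

(** If the two exponents differed, the quotient with the smaller one would still be divisible by
    [exc d]. *)
Lemma strict1_unique d G G1 G2 : strict1 d G G1 -> strict1 d G G2 -> G1 = G2.
Proof.
wlog: G1 G2 / exists m n, [/\ pull d G = exc d ^+ m * G1, pull d G = exc d ^+ n * G2
    & (m <= n)%N].
  move=> wlogH s1 s2; case: (s1) (s2) => [[m e1] _] [[n e2] _].
  case: (leqP m n) => [le_mn|/ltnW le_nm]; first by apply: wlogH => //; exists m, n.
  by apply/esym; apply: wlogH => //; exists n, m.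
move=> [m [n [e1 e2 le_mn]]] [_ nd] _.
have : G1 = exc d ^+ (n - m) * G2.
  apply: (mulfI (expf_neq0 m (exc_neq0 d))).
  by rewrite -e1 e2 mulrA -exprD subnKC.
case: (n - m)%N => [|k] eG1; first by rewrite eG1 mul1r.
by case: nd; exists (exc d ^+ k * G2); rewrite mulrA -exprS.
Qed.

Lemma strict_unique q G G1 G2 : strict q G G1 -> strict q G G2 -> G1 = G2.
Proof.
elim: q G => [|d q IHq] G /=; first by move=> -> ->.
by move=> [M1 s1 t1] [M2 s2 t2]; move: t1; rewrite (strict1_unique s1 s2) => /IHq; apply.
Qed.

Lemma strict_rcons q d G G1 :
  strict (rcons q d) G G1 <-> exists2 M, strict q G M & strict1 d M G1.
Proof.
elim: q G => [|e q IHq] G /=.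
  by split=> [[M s1 ->]|[M -> s1]]; [exists G | exists G1].
split=> [[M s1 /IHq[M' s2 s3]]|[M' [M s1 s2] s3]].
  by exists M' => //; exists M.
by exists M => //; apply/IHq; exists M'.
Qed.

End Restrictions.

(** * Typical and atypical fibres at the end of a chain, and irreducibility of its germ *)

Section Fibres.

Variable F : fieldType.
Implicit Types (A B C G H M R W : {poly {poly F}}) (d : P1 F) (q s : ipoint F).
Implicit Types (a b : {poly F}) (t tau lambda mu : F) (K : seq (ipoint F)).
Local Notation total := Defs.total.

Lemma strict1_of_at_origin d G m G1 :
  pull d G = exc d ^+ m * G1 -> at_origin G1 != 0 -> strict1 d G G1.
Proof.
move=> pullG G10; apply: strict1_of_restr pullG _; apply: contra G10 => /eqP r0.
by rewrite (at_origin_restr d) r0 coef0.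
Qed.

(** A fibre of value other than [tau] keeps the multiplicities of [G]: its restriction is
    [(lambda - t mu) X^m], with non-zero coefficient whether [mu = 0] or [lambda = tau mu]. *)
Lemma tower_strict tau s G H t : t != tau -> tower tau s G H ->
  exists R W, [/\ strict s (G - t%:P%:P * H) ('X + 'X%:P * (R - t%:P%:P * W)),
                  at_origin W != 0 & at_origin R = tau * at_origin W].
Proof.
move=> t_tau; elim: s G H => [|d s IHs] G H.
  by move=> [R [W [-> -> W0 RW]]]; exists R, W; split=> //=; ring.
move=> [G1 [H1 [[m [lambda [mu [pullG pullH restrG restrH [lam0 lam]]]]] /IHs]]].
move=> [R [W [sG1 W0 RW]]]; exists R, W; split=> //=.
exists (G1 - t%:P%:P * H1) => //; apply: (@strict1_of_restr _ _ _ m).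
  by rewrite pullB pullM pull_const pullG pullH mulrBr mulrCA.
rewrite restrB restrM restr_const restrG restrH mul_polyC scalerA -scalerBl.
rewrite scaler_eq0 negb_or (monic_neq0 (monicXn _ m)) andbT.
case: lam => [->|lamE]; first by rewrite mulr0 subr0.
move: lam0; rewrite lamE mulf_eq0 negb_or => /andP[_ mu0].
by rewrite -mulrBl mulf_neq0 // subr_eq0 eq_sym.
Qed.

Lemma prefix_size_eq q s d w : prefix (s ++ d :: w) s = false.
Proof.
by apply/negP => /size_prefix; rewrite size_cat /= addnS ltnNge leq_addr.
Qed.

Lemma point_of_last_component s K q L : K =i prefixes s ->
  point_of_component K s q L <-> exists2 d, q = rcons s d & L = exc d.
Proof.
move=> eqK; split=> [[[nq parent] [d [w [qE sL L0]]]]|[d -> ->]].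
  case/lastP: w => [|w e] in qE sL.
    by exists d; rewrite // qE cats1.
  (* A point further up would need a blown-up parent longer than [s], outside the chain. *)
  have := parent (s ++ d :: w) e.
  by rewrite qE -rcons_cons -rcons_cat eqK mem_prefixes prefix_size_eq // => /(_ erefl).
split; last by exists d, [::]; rewrite at_origin_exc cats1.
split=> [|q' d' /rcons_inj[<- _]]; rewrite eqK mem_prefixes ?prefix_refl //.
by rewrite -cats1 prefix_size_eq.
Qed.

(** The fibre [v + u R'] at [s] lifts to a curve meeting the last exceptional curve only in the
    direction [Some (- R'(0))]. It is smooth and transversal there, as [v] has coefficient 1. *)
Lemma tower_typical tau s G H t K : t != tau -> tower tau s G H -> K =i prefixes s ->
  typical G H K s 1 t.
Proof.
move=> t_tau towerG eqK.
have [R [W [sG W0 RW]]] := tower_strict t_tau towerG.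
set R' := R - t%:P%:P * W in sG; set sigma := at_origin R'.
have pullC d : pull d ('X + 'X%:P * R') =
    exc d ^+ 1 * (if d is Some c then 'X + c%:P%:P + pull d R'
                  else 1 + 'X%:P * pull d R').
  by case: d => [c|]; rewrite pullD pullM pull_inner pull_outer /=; ring.
pose C d := if d is Some c then 'X + c%:P%:P + pull d R' else 1 + 'X%:P * pull d R'.
have restrC d : restr d (C d) = if d is Some c then 'X + (c + sigma)%:P
                                else 1 + 'X * sigma%:P.
  case: d => [c|]; rewrite /C !restrD ?restrM ?(restr_nat _ 1) restr_pull.
    by rewrite restr_outer restr_const polyCD addrA.
  by rewrite restr_inner.
have strictC d : strict (rcons s d) (G - t%:P%:P * H) (C d).
  apply/strict_rcons; exists ('X + 'X%:P * R') => //.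
  apply: strict1_of_restr (pullC d) _; rewrite restrC.
  case: d => [c|]; first by rewrite -size_poly_gt0 size_XaddC.
  apply/eqP => /(congr1 (horner_eval 0)); rewrite /horner_eval !hornerE ?mul0r ?addr0.
  by apply/eqP; rewrite oner_eq0.
have C0 d : at_origin (C d) = if d is Some c then c + sigma else 1.
  rewrite (at_origin_restr d) restrC -horner_coef0.
  by case: d => [c|]; rewrite !hornerE ?mul0r ?addr0.
pose d0 : P1 F := Some (- sigma).
have C1 : (C d0)`_1`_0 = 1.
  have := congr1 (fun p : {poly F} => p`_1) (restrC d0).
  by rewrite /restr /= coef_swapXY => ->; rewrite coefD coefX coefC addr0.
have irrC : sirreducible (series_of_poly (C d0)).
  by apply: smooth_irreducible; rewrite ?C1 ?oner_eq0 // C0 /= addNr.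
exists (fun _ => rcons s d0), (fun _ => series_of_poly (C d0)); split.
- by move=> i j _; rewrite !ord1.
- move=> i; exists 'X%:P; split.
  + split; first by apply/point_of_last_component => //; exists d0.
    by exists (C d0) => //; apply: branch_of_irreducible.
  + by right; rewrite [series_of_poly _ _ _]C1 oner_eq0.
  rewrite /Defs.transversal [series_of_poly _ 0%N _]C1 !coefC /= coefX ?coef0.
  by rewrite mulr0 mul1r sub0r oppr_eq0 oner_eq0.
move=> q' L' B' [/(point_of_last_component _ _ eqK)[d -> _] [Ct sCt bCt]].
exists ord0; have CtE := strict_unique sCt (strictC d).
  have := branch_at_origin bCt; rewrite CtE C0; case: d {CtE sCt} => [c|] /eqP.
    by rewrite addr_eq0 => /eqP ->.
  by rewrite oner_eq0.
have := branch_at_origin bCt; rewrite CtE C0.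
case: d sCt CtE => [c|] sCt CtE /eqP; last by rewrite oner_eq0.
rewrite addr_eq0 => /eqP cE; rewrite cE in CtE.
by rewrite CtE in bCt; apply: branch_unique.
Qed.

(** [C] is the strict transform at the point [s] itself. As it misses that point, the fibre has no
    branch on the last curve, while typicality asks for one. *)
Lemma tower_atypical tau s G H K C : K =i prefixes s ->
    strict s (G - tau%:P%:P * H) C -> at_origin C != 0 ->
  ~ typical G H K s 1 tau.
Proof.
move=> eqK sC C0 [q [B [_ /(_ ord0)[L [[pq [Ct sCt bCt]] _ _]] _]]].
have [d qE _] := proj1 (point_of_last_component _ _ eqK) pq.
move: sCt; rewrite qE => /strict_rcons[M sM [[m pullM] _]].
move: C0; rewrite -(strict_unique sM sC) -(at_origin_pull d) pullM rmorphM /=.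
by rewrite (branch_at_origin bCt) mulr0 eqxx.
Qed.

Theorem tower_atypical_value tau s G H C t : tower tau s G H ->
    strict s (G - tau%:P%:P * H) C -> at_origin C != 0 ->
  atypical_at_dicritical G H t <-> t = tau.
Proof.
move=> towerG sC C0; split=> [[K [minK [s' [n [[s'K deg n_gt0] ntyp]]]]]|->].
  have eqK := proj1 (tower_minimal_resolution K towerG) minK.
  rewrite eqK mem_prefixes in s'K.
  have nE := tower_restriction_degree towerG s'K deg.
  case: (eqVneq s' s) nE n_gt0 => [s's|_] -> // _ in ntyp *; rewrite s's in ntyp *.
  apply/eqP; apply: contraPT ntyp => t_tau; apply.
  exact: tower_typical t_tau towerG eqK.
exists (prefixes s); split; first by apply/(tower_minimal_resolution _ towerG).
exists s, 1%N; split; last exact: tower_atypical sC C0.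
by split=> //; [rewrite mem_prefixes prefix_refl | apply: tower_dicritical towerG].
Qed.

(** A factorization would descend the chain by [factors_pull] to the smooth germ [v + u R]. *)
Lemma tower_irreducible tau s G H : tower tau s G H -> sirreducible (series_of_poly G).
Proof.
move=> towerG; have [nfG G0] : ~ factors (series_of_poly G) /\ at_origin G = 0.
  elim: s G H towerG => [|d s IHs] G H.
    move=> [R [W [-> _ _ _]]]; set M := 'X + _.
    have restrM : restr (Some 0) M = 'X.
      by rewrite restrD restrM restr_inner restr_outer mul0r addr0.
    have M0 : at_origin M = 0 by rewrite (at_origin_restr (Some 0)) restrM coefX.
    split=> // -[P [Q [P0 Q0 MPQ]]].
    have /smooth_irreducible[//|_ irrM] : at_origin M = 0 := M0.
      have := congr1 (fun p : {poly F} => p`_1) restrM.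
      by rewrite /restr /= coef_swapXY coefX => ->; rewrite oner_eq0.
    by case: (irrM _ _ MPQ) => /sunitP.
  move=> [G1 [H1 [[m [lambda [mu [pullG pullH restrG restrH [lam0 _]]]]] /IHs]]].
  move=> [nfG1 G10]; split; first by move/(factors_pull lam0 pullG restrG).
  by rewrite -(at_origin_pull d) pullG rmorphM /= G10 mulr0.
by apply: sirreducibleP.
Qed.

End Fibres.

(** * The polynomial [p] and its two base points *)

Section Polynomial.

Variable F : numFieldType.
Local Notation u := ('X%:P : {poly {poly F}}).
Local Notation v := ('X : {poly {poly F}}).
Local Notation "[ 'cst' c ]" := ((c : F)%:P%:P : {poly {poly F}}).

Local Arguments Poly : simpl never.

Definition poly_xy : {poly {poly F}} :=
    u ^+ 6 * v ^+ 5 - 5 * u ^+ 5 * v ^+ 4 + 10 * u ^+ 4 * v ^+ 3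
    - 2 * u ^+ 3 * v ^+ 3 - 10 * u ^+ 3 * v ^+ 2 + 5 * u ^+ 2 * v ^+ 2
    + 5 * u ^+ 2 * v - [cst 15 / 4] * u * v - u + v.

(** Row [j] lists the coefficients of [y^j] by powers of [x]; no row ends in zero, so the sizes
    bounding the sums of the definitions compute. *)
Definition coefficients : seq (seq F) :=
  [:: [:: 0; -1]; [:: 1; - (15 / 4); 5]; [:: 0; 0; 5; -10];
      [:: 0; 0; 0; -2; 10]; [:: 0; 0; 0; 0; 0; -5]; [:: 0; 0; 0; 0; 0; 0; 1]].

Lemma poly_xyE : poly_xy = Poly (map (@Poly F) coefficients).
Proof.
by rewrite /poly_xy /coefficients /= /Poly /= !cons_poly_def ?polyC0; ring.
Qed.

Lemma polyseq_row (r : seq F) : last 1 r != 0 -> polyseq (Poly r) = r.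
Proof. exact: PolyK. Qed.

Lemma polyseq_poly_xy : polyseq poly_xy = map (@Poly F) coefficients.
Proof.
rewrite poly_xyE (@PolyK _ 0) //= -size_poly_gt0 polyseq_row //=.
by rewrite oner_eq0.
Qed.

Lemma row_nz (r : seq F) : last 1 r != 0 -> r != [::] -> Poly r != 0.
Proof. by move=> lr; rewrite -size_poly_gt0 polyseq_row //; case: r {lr}. Qed.

Lemma tdeg_poly_xy : tdeg poly_xy = 11%N.
Proof.
have nz r : last 1 r != 0 -> r != [::] -> (Poly r != 0) = true := @row_nz r.
rewrite /tdeg polyseq_poly_xy /= big_mkcond !big_ord_recl big_ord0 /=.
by rewrite !nz ?polyseq_row //= ?oppr_eq0 ?oner_eq0 ?pnatr_eq0.
Qed.

Lemma sum_coefficients (R : nzRingType) (f : F -> nat -> nat -> R) :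
  (forall i j, f 0 i j = 0) ->
  \sum_(j < size poly_xy) \sum_(i < size poly_xy`_j) f poly_xy`_j`_i i j =
    f (-1) 1 0 + f 1 0 1 + f (- (15/4)) 1 1 + f 5 2 1 + f 5 2 2 + f (-10) 3 2
    + f (-2) 3 3 + f 10 4 3 + f (-5) 5 4 + f 1 6 5.
Proof.
move=> f0; rewrite polyseq_poly_xy /= !big_ord_recl big_ord0 /=.
rewrite !polyseq_row /= ?oppr_eq0 ?oner_eq0 ?pnatr_eq0 //.
rewrite !big_ord_recl !big_ord0 /= !f0.
by rewrite !(add0r, addr0) /bump /= !addrA.
Qed.

Lemma homogenize_poly_xy (X Y Z : {poly {poly F}}) :
  homogenize poly_xy X Y Z =
    X ^+ 6 * Y ^+ 5 - 5 * X ^+ 5 * Y ^+ 4 * Z ^+ 2 + 10 * X ^+ 4 * Y ^+ 3 * Z ^+ 4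
    - 2 * X ^+ 3 * Y ^+ 3 * Z ^+ 5 - 10 * X ^+ 3 * Y ^+ 2 * Z ^+ 6
    + 5 * X ^+ 2 * Y ^+ 2 * Z ^+ 7 + 5 * X ^+ 2 * Y * Z ^+ 8
    - [cst 15 / 4] * X * Y * Z ^+ 9 - X * Z ^+ 10 + Y * Z ^+ 10.
Proof.
rewrite /homogenize tdeg_poly_xy.
rewrite (sum_coefficients 
  (f := fun c i j => c%:P%:P * X ^+ i * Y ^+ j * Z ^+ (11 - i - j))).
  rewrite !subSS !subn0; ring.
by move=> i j; rewrite !polyC0 !mul0r.
Qed.

Lemma top_form_poly_xy (a b : F) : top_form poly_xy a b = a ^+ 6 * b ^+ 5.
Proof.
rewrite /top_form tdeg_poly_xy.
under eq_bigr => j _ do rewrite big_mkcond.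
rewrite (sum_coefficients (f := fun c i j =>
  if (i + j == 11)%N then c * a ^+ i * b ^+ j else 0)) /= ?mul1r ?add0r //.
by move=> i j; rewrite !mul0r if_same.
Qed.

End Polynomial.

Ltac expand_pull := rewrite ?(pull1, pull_nat, pullB, pullD, pullM, pullX, pull_const,
  pull_inner, pull_outer) /=.
Ltac pull_ring := expand_pull; ring.
Ltac expand_restr := rewrite ?(restr1, restr_nat, restrB, restrD, restrM, restrX,
  restr_const,  restr_inner, restr_outer) ?expr0n /= -?mul_polyC.
Ltac restr_ring := expand_restr; ring.

Ltac expand_origin := rewrite ?(at_origin1, at_origin_nat, at_originB, at_originD,
  at_originM, at_originX, at_origin_const, at_origin_inner, at_origin_outer)
  ?expr0n /=.
Ltac origin_ring := expand_origin; ring.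

(** * The chain over [1 : 0 : 0] *)

Section FirstBasePoint.

Variable F : fieldType.
Variable kappa : F.
Local Notation u := ('X%:P : {poly {poly F}}).
Local Notation v := ('X : {poly {poly F}}).
Local Notation k := (kappa%:P%:P : {poly {poly F}}).

(** The tangent cones are [v^5], then [(v - u)^5], then four times a multiple of [u]. *)
Definition first_directions : ipoint F := [:: Some 0; Some 1; None; None; None; None].

Definition first_germ := (v - u ^+ 2) ^+ 5 - 2 * v ^+ 3 * u ^+ 5 + 5 * v ^+ 2 * u ^+ 7
          - k * v * u ^+ 9 + v * u ^+ 10.
Definition first_germ1 := (v - u) ^+ 5 - 2 * v ^+ 3 * u ^+ 3 + 5 * v ^+ 2 * u ^+ 4
          - k * v * u ^+ 5 + v * u ^+ 6.
(** [e] counts the blow-ups in direction [None]; each replaces [u] by [u v], which only affects the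
    last term. *)
Definition first_tail e :=
  3 - k + (4 - k) * v - v ^+ 2 - 2 * v ^+ 3 + (v + 1) * u * v ^+ e.
Definition first_germ2 e := v ^+ (5 - e) + u * first_tail e.

Lemma first_tower :
  3 - kappa != 0 -> tower (3 - kappa) first_directions first_germ (u ^+ 11).
Proof.
move=> tau0; exists first_germ1, (u ^+ 6); split.
  (* With [mu = 0] the pencil is infinite on this curve. *)
  exists 5%N, 1, 0; split; rewrite ?oner_eq0; try (by split; [|left]).
  - rewrite /first_germ /first_germ1 /=; pull_ring.
  - pull_ring.
  - restr_ring.
  - restr_ring.
exists (first_germ2 0), u; split.
  exists 5%N, 1, 0; split; rewrite ?oner_eq0; try (by split; [|left]).
  - rewrite /first_germ1 /first_germ2 /first_tail /=; pull_ring.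
  - pull_ring.
  - restr_ring.
  - restr_ring.
have step e : (e < 4)%N ->
    blowup_step (3 - kappa) None (first_germ2 e) u (first_germ2 e.+1) u.
  (* From here on the pencil takes the value [first_tail e] at the origin, [3 - kappa], all along
     the new curve. *)
  move=> lt_e; exists 1%N, (3 - kappa), 1; split.
  - rewrite /first_germ2 /first_tail /= (_ : (5 - e = (5 - e.+1).+1)%N); last by lia.
    expand_pull; rewrite !(exprSr _ e) !(exprS _ (5 - e.+1)).
    move: ('X ^+ (5 - e.+1)) ('X ^+ e) => a b.
    by ring.
  - pull_ring.
  - rewrite /first_germ2 (_ : (5 - e.+1 = (3 - e).+1)%N); last by lia. restr_ring.
  - restr_ring.
  by split=> //; right; rewrite mulr1.
do 4 (eexists; eexists; split; first by apply: step).
exists (first_tail 4), 1; split; rewrite ?mulr1 ?at_origin1 ?oner_eq0 //.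
rewrite /first_tail; origin_ring.
Qed.

Definition first_strict_atypical :=
  1 + u * (4 - k - v - 2 * v ^+ 2) + (v + 1) * u ^+ 2 * v ^+ 3.

Lemma first_atypical_at_origin : at_origin first_strict_atypical != 0.
Proof.
rewrite (_ : at_origin _ = 1) ?oner_eq0 // /first_strict_atypical; origin_ring.
Qed.

(** Subtracting the value kills the linear term in [u], so the third multiplicity rises from 1 to 2.
    [4 - kappa] is the coefficient that keeps the later restrictions non-zero. *)
Lemma first_atypical_strict : 4 - kappa != 0 ->
  strict first_directions (first_germ - (3 - kappa)%:P%:P * u ^+ 11)
    first_strict_atypical.
Proof.
move=> nz4.
have -> : (3 - kappa)%:P%:P = 3 - k by rewrite !rmorphB /= !rmorph_nat.
have X0 : ('X : {poly F}) != 0 by rewrite polyX_eq0.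
exists (first_germ1 - (3 - k) * u ^+ 6).
  apply: (@strict1_of_restr _ _ _ 5); first by rewrite /first_germ /first_germ1; pull_ring.
  rewrite (_ : restr _ _ = 'X ^+ 5) ?expf_neq0 // /first_germ1; restr_ring.
exists (v ^+ 5 + u * ((4 - k) * v - v ^+ 2 - 2 * v ^+ 3 + (v + 1) * u)).
  apply: (@strict1_of_restr _ _ _ 5); first by rewrite /first_germ1; pull_ring.
  rewrite (_ : restr _ _ = 'X ^+ 5) ?expf_neq0 //; restr_ring.
exists (v ^+ 3 + u * (4 - k - v - 2 * v ^+ 2 + (v + 1) * u)).
  apply: (@strict1_of_restr _ _ _ 2); first by pull_ring.
  rewrite (_ : restr _ _ = 'X * ('X + (4 - kappa)%:P)); last by restr_ring.
  by rewrite mulf_neq0 // -size_poly_gt0 size_XaddC.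
exists (v ^+ 2 + u * (4 - k - v - 2 * v ^+ 2) + (v + 1) * u ^+ 2 * v).
  apply: (@strict1_of_restr _ _ _ 1); first by pull_ring.
  rewrite (_ : restr _ _ = (4 - kappa)%:P * 'X); last by restr_ring.
  by rewrite mulf_neq0 // polyC_eq0.
exists (v + u * (4 - k - v - 2 * v ^+ 2) + (v + 1) * u ^+ 2 * v ^+ 2).
  apply: (@strict1_of_restr _ _ _ 1); first by pull_ring.
  rewrite (_ : restr _ _ = (4 - kappa)%:P * 'X); last by restr_ring.
  by rewrite mulf_neq0 // polyC_eq0.
exists first_strict_atypical => //.
apply: (@strict1_of_at_origin _ _ _ 1); last exact: first_atypical_at_origin.
by rewrite /first_strict_atypical; pull_ring.
Qed.

End FirstBasePoint.

(** * The chain over [0 : 1 : 0] *)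

Section SecondBasePoint.

Variable F : fieldType.
Variables beta kappa : F.
Hypothesis beta_eq : beta * 2 = 5.
Hypothesis kappa_eq : kappa = 10 - beta ^+ 2.
Local Notation u := ('X%:P : {poly {poly F}}).
Local Notation v := ('X : {poly {poly F}}).
Local Notation k := (kappa%:P%:P : {poly {poly F}}).
Local Notation b := (beta%:P%:P : {poly {poly F}}).

(** The tangent cones are [v^6], [u^4], [v^2], [(v - u)^2], then [v^2 - 5 u v + (10 - kappa) u^2],
    and a multiple of [u]. The relations on [beta] and [kappa] make the fifth one the square of
    [v - beta u]. *)
Definition second_directions : ipoint F :=
  [:: Some 0; None; Some 0; Some 1; Some beta; None].

(** The value of [second_tail] at the origin, where [w = 1] and [y = 0]. *)
Definition second_value : F := - 5 * beta ^+ 2 + (20 - kappa) * beta - 10.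
Local Notation tau := second_value.
Local Notation T := (tau%:P%:P : {poly {poly F}}).

Definition second_germ := v ^+ 6 - 5 * v ^+ 5 * u ^+ 2 + 10 * v ^+ 4 * u ^+ 4
  - 2 * v ^+ 3 * u ^+ 5 - 10 * v ^+ 3 * u ^+ 6 + 5 * v ^+ 2 * u ^+ 7
  + 5 * v ^+ 2 * u ^+ 8 - k * v * u ^+ 9 - v * u ^+ 10 + u ^+ 10.
Definition second_germ1 := v ^+ 6 - 5 * v ^+ 5 * u + 10 * v ^+ 4 * u ^+ 2
  - 2 * v ^+ 3 * u ^+ 2 - 10 * v ^+ 3 * u ^+ 3 + 5 * v ^+ 2 * u ^+ 3
  + 5 * v ^+ 2 * u ^+ 4 - k * v * u ^+ 4 - v * u ^+ 5 + u ^+ 4.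
Definition second_germ2 := v ^+ 2 - 5 * v ^+ 2 * u + 10 * v ^+ 2 * u ^+ 2
  - 2 * v * u ^+ 2 - 10 * v ^+ 2 * u ^+ 3 + 5 * v * u ^+ 3 + 5 * v ^+ 2 * u ^+ 4
  - k * v * u ^+ 4 - v ^+ 2 * u ^+ 5 + u ^+ 4.
Definition second_germ3 := v ^+ 2 - 5 * v ^+ 2 * u + 10 * v ^+ 2 * u ^+ 2
  - 2 * v * u - 10 * v ^+ 2 * u ^+ 3 + 5 * v * u ^+ 2 + 5 * v ^+ 2 * u ^+ 4
  - k * v * u ^+ 3 - v ^+ 2 * u ^+ 5 + u ^+ 2.
Definition second_germ4 := v ^+ 2 + u * (5 * (v + 1) - 5 * (v + 1) ^+ 2)
  + u ^+ 2 * (10 * (v + 1) ^+ 2 - k * (v + 1)) - 10 * (v + 1) ^+ 2 * u ^+ 3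
  + 5 * (v + 1) ^+ 2 * u ^+ 4 - (v + 1) ^+ 2 * u ^+ 5.

(* From the fifth blow-up on, the pencil is [v ^+ m + u * second_tail w y] over
   [u * w], where [w] is a unit and [y] is the total transform of [u]. *)
Definition second_tail (w y : {poly {poly F}}) :=
  - 5 * (v + b) ^+ 2 + (20 - k) * (v + b) + 10 * y * (v + b) ^+ 2
  - 10 * w ^+ 2 + 5 * w ^+ 2 * y - w ^+ 2 * y ^+ 2.
Definition second_unit5 := u * (v + b) + 1.
Definition second_unit6 := u * v * (v + b) + 1.
Local Notation V5 := second_unit5.
Local Notation V6 := second_unit6.
Local Notation G5 := (v ^+ 2 + u * second_tail V5 u).
Local Notation G6 := (v + u * second_tail V6 (u * v)).

Lemma second_constants : b * 2 = 5 /\ k = 10 - b ^+ 2.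
Proof.
split.
  have := congr1 (fun c : F => c%:P%:P) beta_eq.
  by rewrite !rmorphM /= !rmorph_nat.
by rewrite kappa_eq !(polyCB, polyC_exp) !rmorph_nat.
Qed.

Lemma second_value_const : T = - 5 * b ^+ 2 + (20 - k) * b - 10.
Proof.
have polyCn (S : nzRingType) n : (n%:R : S)%:P = n%:R := rmorph_nat polyC n.
by rewrite /second_value !(polyCn, polyCB, polyCD, polyCM, polyCN, polyC_exp).
Qed.

Lemma restr_unit5 c : restr (Some c) V5 = 1.
Proof. by rewrite /second_unit5; restr_ring. Qed.

Lemma restr_unit6 : restr None V6 = 1.
Proof. by rewrite /second_unit6; restr_ring. Qed.

Lemma at_origin_unit6 : at_origin V6 = 1.
Proof. by rewrite /second_unit6; origin_ring. Qed.

Lemma pull_unit5 : pull None V5 = V6.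
Proof. by rewrite /second_unit5 /second_unit6; pull_ring. Qed.

Lemma pull_germ4 : pull (Some beta) second_germ4 = u ^+ 2 * G5.
Proof.
have [bE kE] := second_constants.
rewrite /second_germ4 /second_tail /second_unit5; expand_pull; ring: bE kE.
Qed.

Lemma pull_germ5 : pull None G5 = v * G6.
Proof.
(* The units are kept abstract, so that the ring identity treats the pull-back of [w] as an atom. *)
rewrite /second_tail; move: V5 V6 pull_unit5 => w w' <-; pull_ring.
Qed.

Lemma restr_germ5 c : restr (Some c) G5 = 'X ^+ 2.
Proof.
rewrite /second_tail; move: V5 (restr_unit5 c) => w ew.
expand_restr; rewrite ?ew; ring.
Qed.

Lemma restr_germ6 : restr None G6 = tau%:P * 'X.
Proof.
rewrite /second_value /second_tail; move: V6 restr_unit6 => w ew.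
expand_restr; rewrite ew; ring.
Qed.

Lemma second_tower : tau != 0 -> tower tau second_directions second_germ (u ^+ 11).
Proof.
move=> tau0.
exists second_germ1, (u ^+ 5); split.
  exists 6%N, 1, 0; split; rewrite ?oner_eq0; try (by split; [|left]).
  - rewrite /second_germ /second_germ1; pull_ring.
  - pull_ring.
  - rewrite /second_germ1; restr_ring.
  - restr_ring.
exists second_germ2, (u ^+ 5 * v); split.
  exists 4%N, 1, 0; split; rewrite ?oner_eq0; try (by split; [|left]).
  - rewrite /second_germ1 /second_germ2; pull_ring.
  - pull_ring.
  - rewrite /second_germ2; restr_ring.
  - restr_ring.
exists second_germ3, (u ^+ 4 * v); split.
  exists 2%N, 1, 0; split; rewrite ?oner_eq0; try (by split; [|left]).
  - rewrite /second_germ2 /second_germ3; pull_ring.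
  - pull_ring.
  - rewrite /second_germ3; restr_ring.
  - restr_ring.
exists second_germ4, (u ^+ 3 * (v + 1)); split.
  exists 2%N, 1, 0; split; rewrite ?oner_eq0; try (by split; [|left]).
  - rewrite /second_germ3 /second_germ4; pull_ring.
  - pull_ring.
  - rewrite /second_germ4; restr_ring.
  - restr_ring.
exists G5, (u * V5); split.
  exists 2%N, 1, 0; split; rewrite ?oner_eq0; try (by split; [|left]).
  - exact: pull_germ4.
  - rewrite /second_unit5; pull_ring.
  - by rewrite restr_germ5 scale1r.
  - by rewrite restrM restr_inner mul0r scale0r.
exists G6, (u * V6); split.
  exists 1%N, tau, 1; split.
  - exact: pull_germ5.
  - rewrite pullM pull_unit5 pull_inner /=; ring.
  - by rewrite restr_germ6 mul_polyC.
  - by rewrite restrM restr_unit6 restr_inner mulr1 scale1r.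
  by split=> //; right; rewrite mulr1.
exists (second_tail V6 (u * v)), V6; split; rewrite ?at_origin_unit6 ?oner_eq0 //.
rewrite mulr1 /second_value /second_tail; move: V6 at_origin_unit6 => w ew.
expand_origin; rewrite ew; ring.
Qed.

(** Subtracting the value cancels the linear term of [G5], so the last blow-up divides by [v^2]
    instead of [v], leaving constant term 1. *)
Definition second_strict_atypical :=
  1 + u * (- 5 * (v + 2 * b) + (20 - k) + 10 * u * (v + b) ^+ 2
           - 10 * (u * (v + b)) * (2 + u * v * (v + b)) + 5 * V6 ^+ 2 * u
           - V6 ^+ 2 * u ^+ 2 * v - T * u * (v + b)).
Local Notation C6 := second_strict_atypical.

Lemma at_origin_strict_atypical : at_origin C6 != 0.
Proof.
rewrite /second_strict_atypical at_originD at_origin1 at_originM at_origin_inner mul0r.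
rewrite addr0; exact: oner_neq0.
Qed.

Lemma second_atypical_strict : strict second_directions (second_germ - T * u ^+ 11) C6.
Proof.
have X0 : ('X : {poly F}) != 0 by rewrite polyX_eq0.
exists (second_germ1 - T * u ^+ 5).
  apply: (@strict1_of_restr _ _ _ 6).
    by rewrite /second_germ /second_germ1; pull_ring.
  rewrite (_ : restr _ _ = 'X ^+ 6) ?expf_neq0 // /second_germ1; restr_ring.
exists (second_germ2 - T * (u ^+ 5 * v)).
  apply: (@strict1_of_restr _ _ _ 4).
    by rewrite /second_germ1 /second_germ2; pull_ring.
  rewrite (_ : restr _ _ = 'X ^+ 4) ?expf_neq0 // /second_germ2; restr_ring.
exists (second_germ3 - T * (u ^+ 4 * v)).
  apply: (@strict1_of_restr _ _ _ 2).
    by rewrite /second_germ2 /second_germ3; pull_ring.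
  rewrite (_ : restr _ _ = 'X ^+ 2) ?expf_neq0 // /second_germ3; restr_ring.
exists (second_germ4 - T * (u ^+ 3 * (v + 1))).
  apply: (@strict1_of_restr _ _ _ 2).
    by rewrite /second_germ3 /second_germ4; pull_ring.
  rewrite (_ : restr _ _ = 'X ^+ 2) ?expf_neq0 // /second_germ4; restr_ring.
exists (G5 - T * (u * V5)).
  apply: (@strict1_of_restr _ _ _ 2).
    rewrite pullB pull_germ4 [RHS]mulrBr; congr (_ - _); rewrite /second_unit5; pull_ring.
  rewrite restrB restr_germ5 restrM (restrM _ u) restr_inner mul0r mulr0 subr0.
  by rewrite expf_neq0.
exists C6 => //.
apply: (@strict1_of_at_origin _ _ _ 2); last exact: at_origin_strict_atypical.
rewrite pullB pull_germ5 !pullM pull_const pull_unit5 pull_inner second_value_const.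
rewrite /second_tail /second_strict_atypical second_value_const /second_unit6 /=; ring.
Qed.

End SecondBasePoint.

(** * Critical values and branches at infinity of the given polynomial *)

Section CriticalValues.

Variable F : numFieldType.
Local Notation f := (poly_xy F).
Local Notation u := ('X%:P : {poly {poly F}}).

Definition first_value : F := 3 - 15 / 4.
Local Notation value2 := (second_value (5 / 2) (15 / 4 : F)).

Lemma nat_div2 n : (n%:R / 2 : F) * 2 = n%:R.
Proof. by rewrite divfK // pnatr_eq0. Qed.

Lemma fifteen_quarters : (15 / 4 : F) = 10 - (5 / 2) ^+ 2.
Proof. by field. Qed.

Lemma first_valueE : first_value = - (3 / 4).
Proof. by rewrite /first_value; field. Qed.

Lemma second_valueE : value2 = - (5 / 8).
Proof. by rewrite /second_value; field. Qed.

Lemma first_value_neq0 : first_value != 0.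
Proof. by rewrite first_valueE oppr_eq0 mulf_neq0 ?invr_eq0 ?pnatr_eq0. Qed.

Lemma second_value_neq0 : value2 != 0.
Proof. by rewrite second_valueE oppr_eq0 mulf_neq0 ?invr_eq0 ?pnatr_eq0. Qed.

Lemma first_value_neq_second : first_value <> value2.
Proof.
rewrite first_valueE second_valueE => /eqP; rewrite eqr_opp -subr_eq0.
have -> : 3 / 4 - 5 / 8 = 8^-1 :> F by field.
by rewrite invr_eq0 pnatr_eq0.
Qed.

Lemma germ_first : germ_at_infinity f (Some 0) = first_germ (15 / 4).
Proof.
by rewrite /= homogenize_poly_xy !polyC0 addr0 /first_germ; ring.
Qed.

Lemma germ_second : germ_at_infinity f None = second_germ (15 / 4).
Proof. by rewrite /= homogenize_poly_xy /second_germ; ring. Qed.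

Lemma first_tower_xy :
  tower first_value (first_directions F) (germ_at_infinity f (Some 0)) (u ^+ 11).
Proof. by rewrite germ_first; apply: first_tower; apply: first_value_neq0. Qed.

Lemma second_tower_xy :
  tower value2 (second_directions (5 / 2)) (germ_at_infinity f None) (u ^+ 11).
Proof.
rewrite germ_second; apply: second_tower second_value_neq0; first exact: nat_div2.
exact: fifteen_quarters.
Qed.

Lemma at_origin_germ b : at_origin (germ_at_infinity f (Some b)) = b ^+ 5.
Proof. by rewrite /= homogenize_poly_xy; origin_ring. Qed.

Lemma base_point_xy P : base_point f P <-> P = Some 0 \/ P = None.
Proof.
case: P => [b|] /=; rewrite top_form_poly_xy.
  rewrite expr1n mul1r; split=> [/eqP|[[->]|//]]; last by rewrite expr0n.
  by rewrite expf_eq0 /= => /eqP ->; left.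
by rewrite expr0n mul0r; split=> // _; right.
Qed.

Lemma critical_value_xy t :
  critical_value_at_infinity f t <-> t = first_value \/ t = value2.
Proof.
have first_at := tower_atypical_value t first_tower_xy.
have nz4 : 4 - 15 / 4 != 0 :> F.
  by rewrite (_ : 4 - 15 / 4 = 4^-1) ?invr_eq0 ?pnatr_eq0 //; field.
have := first_atypical_strict nz4; rewrite -germ_first => /first_at.
move=> /(_ (first_atypical_at_origin _)) {}first_at.
have second_at := tower_atypical_value t second_tower_xy.
have := second_atypical_strict (nat_div2 5) fifteen_quarters.
rewrite -germ_second => /second_at.
move=> /(_ (at_origin_strict_atypical _ _)) {}second_at.
rewrite /critical_value_at_infinity tdeg_poly_xy; split.
  by move=> [P /base_point_xy[->|->]]; [move=> /first_at; left | move=> /second_at; right].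
case=> [/first_at|/second_at] at_t; [exists (Some 0)|exists None] => //; apply/base_point_xy;
  by [left|right].
Qed.

(** Both germs are irreducible, so each of the two points at infinity carries exactly one branch. *)
Lemma number_of_branches_xy : number_of_branches_at_infinity f 2.
Proof.
have irr P : P = Some 0 \/ P = None ->
    sirreducible (series_of_poly (germ_at_infinity f P)).
  by case=> ->; [apply: tower_irreducible first_tower_xy
                |apply: tower_irreducible second_tower_xy].
pose P (i : 'I_2) : P1 F := if i == ord0 then Some 0 else None.
have baseP i : P i = Some 0 \/ P i = None by rewrite /P; case: ifP; [left|right].
exists P, (fun i => series_of_poly (germ_at_infinity f (P i))); split.
- by move=> i; apply: branch_of_irreducible; apply: irr.
- move=> i j + _; rewrite /P; case: eqP => [->|/eqP i0]; case: eqP => [->|/eqP j0] // _.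
  by apply/val_inj; case: i j i0 j0 => [[|[|i]] //= ?] [[|[|j]] //= ?].
move=> P' B' brB'.
have baseP' : P' = Some 0 \/ P' = None.
  case: P' brB' => [b|]; last by right.
  (* A branch at [Some b] forces the germ to vanish there, that is [b ^+ 5 = 0]. *)
  by move/branch_at_origin/eqP; rewrite at_origin_germ expf_eq0 => /eqP ->; left.
have [i PE] : exists i, P' = P i.
  by case: baseP' => ->; [exists ord0 | exists (lift ord0 ord0)].
by exists i => //; rewrite PE in brB' *; apply: branch_unique brB'; apply: irr.
Qed.

End CriticalValues.

Theorem mainTheorem4 (R : realType) :
  let x : {poly {poly R[i]}} := 'X%:P in
  let y : {poly {poly R[i]}} := 'X in
  let p : {poly {poly R[i]}} :=
    x ^+ 6 * y ^+ 5 - 5 * x ^+ 5 * y ^+ 4 + 10 * x ^+ 4 * y ^+ 3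
    - 2 * x ^+ 3 * y ^+ 3 - 10 * x ^+ 3 * y ^+ 2 + 5 * x ^+ 2 * y ^+ 2
    + 5 * x ^+ 2 * y - (15 / 4 : R[i])%:P%:P * x * y - x + y in
  (exists t1 t2 : R[i],
     t1 <> t2 /\
     forall t : R[i],
       (t <> 0 /\ critical_value_at_infinity p t) <-> (t = t1 \/ t = t2))
  /\ number_of_branches_at_infinity p 2.
Proof.
move=> x y p; split; last exact: number_of_branches_xy.
exists (first_value R[i]), (second_value (5 / 2) (15 / 4)).
split=> [|t]; first exact: first_value_neq_second.
split=> [[_ /critical_value_xy]//|tE]; split; last exact/critical_value_xy.
by case: tE => ->; apply/eqP; [apply: first_value_neq0 | apply: second_value_neq0].
Qed.
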